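(* Let $r>1$ be a real number and let $f:[0,1]\to\mathbb{R}$ have smoothness $r$. Suppose that for some integer $s$ with $1\le s\le r$, $\hat f(k)$ decays faster than $b^{-a_1-\cdots-a_s}$ for all $k=\kappa_1b^{a_1-1}+\cdots+\kappa_vb^{a_v-1}$ with $0<\kappa_1,\ldots,\kappa_v<b$ and $v\ge s$, i.e. $$\lim_{a_s\to\infty}b^{a_s}\cdots\lim_{a_2\to\infty}b^{a_2}\lim_{a_1\to\infty}b^{a_1}\hat f(k)=0\quad\text{for all }k\text{ with }v\ge s,$$ meaning that this iterated limit is $0$ for every fixed choice of digits $\kappa_1,\ldots,\kappa_s\in\{1,\ldots,b-1\}$ and every fixed integer $k^{(s)}=\kappa_{s+1}b^{a_{s+1}-1}+\cdots+\kappa_vb^{a_v-1}\ge0$ (with $k^{(s)}=0$ if $v=s$). Then $f$ is a polynomial of degree at most $s-1$.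
   Context: Let $b\ge 2$ be an integer and $\omega_b=e^{2\pi \mathrm{i}/b}$; $\mathbb{N}=\{1,2,\ldots\}$. Each $k\in\mathbb{N}$ has the base $b$ expansion $k=\kappa_1b^{a_1-1}+\cdots+\kappa_vb^{a_v-1}$ with $v\ge1$, $0<\kappa_1,\ldots,\kappa_v<b$ and $a_1>\cdots>a_v>0$ integers; for $k=0$ set $v=0$. For $x\in[0,1)$ with base $b$ representation $x=\frac{x_1}{b}+\frac{x_2}{b^2}+\cdots$, $0\le x_i<b$, infinitely many $x_i\neq b-1$, the $k$th Walsh function is $\mathrm{wal}_k(x)=\omega_b^{\kappa_1x_{a_1}+\cdots+\kappa_vx_{a_v}}$, and $\mathrm{wal}_0(x)=1$. The $k$th Walsh coefficient of $f:[0,1]\to\mathbb{R}$ is $\hat f(k)=\int_0^1f(x)\overline{\mathrm{wal}_k(x)}\,dx$. For $g:[0,1]\to\mathbb{R}$ the variation of order $\lambda$ is $$V_\lambda(g)=\sup_{0=x_0<x_1<\cdots<x_{N-1}<x_N=1}\ \sum_{n=1}^N|x_n-x_{n-1}|\,\frac{|g(x_n)-g(x_{n-1})|}{|x_n-x_{n-1}|^\lambda},$$ the supremum being over all partitions of $[0,1]$. A function $f$ has smoothness $r>1$ if $f$ is $\lfloor r\rfloor$ times differentiable on $[0,1]$ and its $\lfloor r\rfloor$th derivative has bounded variation of order $r-\lfloor r\rfloor$, i.e. $V_{r-\lfloor r\rfloor}(f^{(\lfloor r\rfloor)})<\infty$ (for integer $r$ this is the same formula with $\lambda=0$). In the iterated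 limit the limits are taken from the inside out: first $a_1\to\infty$ with $a_2,\ldots,a_s$ fixed, then $a_2\to\infty$, and so on, always under the constraint $a_1>a_2>\cdots>a_s>a_{s+1}>\cdots>a_v>0$. *)

(* Defs.v *)
(* MathComp / MathComp-Analysis. *)
From mathcomp Require Import all_boot all_order all_algebra.
From mathcomp Require Import complex.
From mathcomp Require Import all_classical all_reals all_analysis.
Set Implicit Arguments.
Unset Strict Implicit.
Unset Printing Implicit Defensive.
Import Order.TTheory GRing.Theory Num.Theory numFieldNormedType.Exports.
Local Open Scope classical_set_scope.
Local Open Scope complex_scope.
Local Open Scope ring_scope.

(* An expansion k = kappa_1 b^(a_1 - 1) + ... + kappa_v b^(a_v - 1) is the
   sequence of pairs (kappa_1, a_1), ..., (kappa_v, a_v); k = 0 is [::]. *)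
Definition is_expansion (b : nat) (e : seq (nat * nat)) : bool :=
  all (fun p => (0 < p.1 < b)%N && (0 < p.2)%N) e && sorted gtn (unzip2 e).

Definition expansion_val (b : nat) (e : seq (nat * nat)) : nat :=
  (\sum_(p <- e) p.1 * b ^ p.2.-1)%N.

(* a_1 *)
Definition lead_exp (e : seq (nat * nat)) : nat := head 0 (unzip2 e).

Definition nat_digit (b k a : nat) : nat := ((k %/ b ^ a.-1) %% b)%N.

(* The positions a > k are omitted since k < b ^ k. *)
Definition expansion_of (b k : nat) : seq (nat * nat) :=
  [seq (nat_digit b k a, a) | a <- rev (iota 1 k) & nat_digit b k a != 0%N].

Lemma expansion_ofP (b k : nat) (hb : (1 < b)%N) :
  is_expansion b (expansion_of b k) /\ expansion_val b (expansion_of b k) = k.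
Proof.
split.
  rewrite /is_expansion /expansion_of; apply/andP; split.
    apply/allP => p /mapP[a]; rewrite mem_filter mem_rev mem_iota.
    move=> /and3P[ha ha1 _] -> /=; rewrite lt0n ha ha1 andbT /=.
    by rewrite /nat_digit ltn_mod (ltn_trans _ hb).
  rewrite /unzip2 -map_comp map_id; apply: sorted_filter.
    by move=> x y z /= h1 h2; exact: ltn_trans h2 h1.
  by rewrite rev_sorted; exact: iota_ltn_sorted.
rewrite /expansion_val /expansion_of big_map big_filter big_mkcond /=.
transitivity (\sum_(a <- iota 1 k) nat_digit b k a * b ^ a.-1)%N.
  rewrite (perm_big (iota 1 k)) /=; last by rewrite perm_rev.
  by apply: eq_bigr => a _; case: eqP => // ->; rewrite mul0n.
have H n : (\sum_(a <- iota 1 n) nat_digit b k a * b ^ a.-1)%N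
           = (k %% b ^ n)%N.
  elim: n => [|n IH]; first by rewrite big_nil expn0 modn1.
  rewrite -{1}(addn1 n) iotaD big_cat /= IH big_seq1 add1n /= /nat_digit /=.
  have b0 : (0 < b ^ n)%N by rewrite expn_gt0 (ltn_trans _ hb).
  have kE : k = ((k %/ b ^ n %/ b) * b ^ n.+1
                 + ((k %/ b ^ n) %% b * b ^ n + k %% b ^ n))%N.
    by rewrite addnA expnS mulnA -mulnDl -divn_eq -divn_eq.
  rewrite [in RHS]kE modnMDl [in LHS]addnC; apply/esym/modn_small.
  apply: (@leq_trans (((k %/ b ^ n) %% b) * b ^ n + b ^ n)%N).
    by rewrite ltn_add2l ltn_mod.
  by rewrite -mulSnr expnS leq_mul2r ltn_mod (ltn_trans _ hb) ?orbT.
by rewrite H modn_small // ltn_expl.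
Qed.

Section Walsh.
Variable R : realType.
Implicit Types (f g : R -> R) (x : R) (b i k : nat).

(* x = d_1 / b + d_2 / b ^ 2 + ... with infinitely many d_i <> b - 1. *)
Definition is_base_rep b x (d : nat -> nat) : Prop :=
  [/\ forall i, (0 < i)%N -> (d i < b)%N,
      (\sum_(1 <= i < n.+1) (d i)%:R / b%:R ^+ i) @[n --> \oo] --> x &
      forall N, exists2 i, (N < i)%N & d i != b.-1].

Definition real_digit b x i : nat := (Num.truncn (x * b%:R ^+ i) %% b)%N.

Lemma real_digitP b x (hb : (1 < b)%N) (hx : 0 <= x < 1) :
  is_base_rep b x (real_digit b x).
Proof.
have b0 : (0 < b)%N by exact: ltn_trans hb.
have c0 : 0 < b%:R :> R by rewrite ltr0n.
have x0 : 0 <= x by case/andP: hx.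
pose F n := Num.truncn (x * b%:R ^+ n).
have F_itv n : (F n)%:R <= x * b%:R ^+ n < (F n).+1%:R.
  by apply: truncn_itv; rewrite mulr_ge0 // exprn_ge0 // ltW.
have FS n : (F n.+1 %/ b)%N = F n.
  apply/esym/truncn_def; have /andP[h1 h2] := F_itv n.+1.
  rewrite -(ler_pM2r c0) -(ltr_pM2r c0) -mulrA -exprSr -!natrM.
  apply/andP; split; first by apply: le_trans h1; rewrite ler_nat leq_divM.
  by apply: lt_le_trans h2 _; rewrite ler_nat ltn_ceil.
have F0 : F 0%N = 0%N.
  by apply/truncn_def; rewrite expr0 mulr1.
have sumF n : \sum_(1 <= i < n.+1) (real_digit b x i)%:R / b%:R ^+ i
              = (F n)%:R / b%:R ^+ n :> R.
  elim: n => [|n IH]; first by rewrite big_geq // F0 mul0r.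
  rewrite big_nat_recr //= IH /real_digit -/(F n.+1) -{1}FS.
  rewrite [in RHS](divn_eq (F n.+1) b) natrD natrM mulrDl; congr (_ + _).
  by rewrite [_ * b%:R]mulrC exprS -mulf_div divff ?mul1r ?gt_eqF.
split.
- by move=> i _; rewrite ltn_mod.
- under eq_fun do rewrite sumF.
  have h : (fun n => x - b%:R^-1 ^+ n) @ \oo --> x.
    rewrite -[X in _ --> X]subr0; apply: cvgB; first exact: cvg_cst.
    by apply: cvg_expr; rewrite ger0_norm ?invr_ge0 ?ltW // invf_lt1 // ltr1n.
  apply: (squeeze_cvgr _ h (@cvg_cst _ x _ _ _)).
  apply: nearW => n; have /andP[h1 h2] := F_itv n.
  have cn : 0 < b%:R ^+ n :> R by rewrite exprn_gt0.
  rewrite ler_pdivrMr // h1 andbT exprVn ler_pdivlMr // mulrBl mulVf ?gt_eqF //.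
  by rewrite lerBlDr natr1 ltW.
- move=> N; apply: contrapT => hN.
  have dE i : (N < i)%N -> real_digit b x i = b.-1.
    by move=> Ni; apply/eqP/negPn/negP => h; apply: hN; exists i.
  have FN n : (F (N + n)%N).+1 = ((F N).+1 * b ^ n)%N.
    elim: n => [|n IH]; first by rewrite addn0 expn0 muln1.
    rewrite addnS (divn_eq (F (N + n).+1%N) b) FS.
    rewrite -[X in (_ + X)%N]/(real_digit b x (N + n).+1%N) dE ?ltnS ?leq_addr //.
    by rewrite -addnS prednK // expnSr mulnA -IH mulSn addnC.
  have /andP[_ hlt] := F_itv N.
  pose eps := (F N).+1%:R - x * b%:R ^+ N.
  have eps0 : 0 < eps by rewrite subr_gt0.
  have epsb n : eps * b%:R ^+ n <= 1.
    have /andP[h _] := F_itv (N + n)%N.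
    rewrite mulrBl -natrX -natrM -FN natrX -mulrA -exprD lerBlDr addrC.
    by rewrite -natr1 lerD2r.
  pose n := (Num.truncn eps^-1).+1.
  have /andP[_ hn] : (Num.truncn eps^-1)%:R <= eps^-1 < n%:R.
    by apply: truncn_itv; rewrite invr_ge0 ltW.
  have := epsb n; apply/negP; rewrite -ltNge -ltr_pdivrMl // mulr1.
  by apply: lt_le_trans hn _; rewrite -natrX ler_nat ltnW // ltn_expl.
Qed.

Definition omega b : R[i] :=
  cos (2%:R * pi / b%:R) +i* sin (2%:R * pi / b%:R).

Definition walsh b k x : R[i] :=
  omega b ^+ (\sum_(p <- expansion_of b k) p.1 * real_digit b x p.2)%N.

Definition cintegral (D : set R) (h : R -> R[i]) : R[i] :=
  (\int[lebesgue_measure]_(x in D) complex.Re (h x)) +i*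
  (\int[lebesgue_measure]_(x in D) complex.Im (h x)).

Definition walsh_coef b f k : R[i] :=
  cintegral `[0, 1[ (fun x => (f x)%:C * (walsh b k x)^*).

(* g is the derivative of f on [0, 1], one-sided at 0 and at 1; the values of
   f and g outside [0, 1] are irrelevant. *)
Definition deriv_on01 f g : Prop :=
  forall x, 0 <= x <= 1 ->
    (f y - f x) / (y - x) @[y --> within `[0, 1] x^'] --> g x.

Fixpoint nderiv_on01 (n : nat) f g : Prop :=
  match n with
  | 0 => forall x, 0 <= x <= 1 -> g x = f x
  | m.+1 => exists2 h : R -> R, deriv_on01 f h & nderiv_on01 m h g
  end.

(* The partition 0 = x_0 < x_1 < ... < x_N = 1 is 0 :: s. *)
Definition order_variation (lambda : R) g : \bar R :=
  ereal_sup [set (\sum_(n < size s)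
      (let d := `|s`_n - (0 :: s)`_n| in
       d * (`|g s`_n - g (0 :: s)`_n| / d `^ lambda)))%:E
    | s in [set s | itv_partition 0 1 s]].

Definition smooth (r : R) f : Prop :=
  exists2 g : R -> R, nderiv_on01 (Num.truncn r) f g &
    (order_variation (r - (Num.truncn r)%:R) g < +oo)%E.

(* The iterated limit
     lim_{a_s -> oo} b^(a_s) ... lim_{a_1 -> oo} b^(a_1) c(k)
   exists and equals l, for the digits ds = [:: kappa_s; ...; kappa_1] (the
   digit of the outermost limit first), where k has the expansion
   (kappa_1, a_1), ..., (kappa_s, a_s) followed by e; every a_j ranges over the
   integers larger than a_{j+1}, the leading exponent of what follows. *)
Fixpoint iterated_limit b (c : nat -> R[i]) (ds : seq nat)
    (e : seq (nat * nat)) (l : R[i]) : Prop :=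
  match ds with
  | [::] => c (expansion_val b e) = l
  | kappa :: ds' => exists u : nat -> R[i],
      (forall a, (lead_exp e < a)%N ->
         iterated_limit b c ds' ((kappa, a) :: e) (u a)) /\
      b%:R ^+ a * u a @[a --> \oo] --> (l : R[i]^o)
  end.

End Walsh.

(* Main.v *)
(* If f' = g is bounded, then b^a times the Walsh coefficient of f at
   kappa b^(a-1) + k' tends to c(kappa) times the Walsh coefficient of g at k',
   with c(kappa) nonzero: translating between the sets of numbers with
   prescribed a-th digit turns the coefficient into an integral of difference
   quotients of f, and dominated convergence applies.  Iterating s times, all
   Walsh coefficients of f^(s) vanish (f^(s) is bounded even if s = r).  By
   orthogonality of the Walsh functions its integrals over b-adic intervals
   vanish, so f^(s-1) is constant. *)
Require Import Defs.
From mathcomp Require Import all_boot all_order all_algebra.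
From mathcomp Require Import complex.
From mathcomp Require Import all_classical all_reals all_analysis.
From mathcomp Require Import measurable_realfun ring lra zify.
Set Implicit Arguments.
Unset Strict Implicit.
Unset Printing Implicit Defensive.
Import Order.TTheory GRing.Theory Num.Theory numFieldNormedType.Exports.
Local Open Scope classical_set_scope.
Local Open Scope ring_scope.

(** * Digits and Walsh functions *)

(** The difference quotients arise from a cancellation: the numbers conj(omega^(kappa d)), d < b,
    sum to 0. After averaging over the a-th digit, f(x) can therefore be subtracted from every
    translated value f(x + (d - x_a) / b^a) at no cost. Times b^a, this difference is (d - x_a) g(x)
    up to a vanishing error. The digit x_a need not converge as a grows, but the same cancellation
    removes it and leaves c(kappa) = (1/b) sum_d d conj(omega^(kappa d)). A bound on g makes f
    Lipschitz, so all quotients share one bound and dominated convergence applies. The top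
    derivative may be bounded and discontinuous. Its integral over a b-adic interval is therefore
    obtained from the same kind of limit: integrated difference quotients of the primitive telescope
    to averages of the primitive next to the two endpoints. *)

Section Digits.
Variables (R : realType) (b : nat).
Hypothesis hb : (1 < b)%N.
Implicit Types x y : R.

Let b_gt0 : (0 < b)%N. Proof. exact: ltnW. Qed.
Let bn_gt0 n : 0 < b%:R ^+ n :> R. Proof. by rewrite exprn_gt0 // ltr0n. Qed.

(** The first n digits of x packed into one integer, the index of the b-adic interval of length
    b^(-n) around x. Digits are handled through these indices rather than through digit series. *)
Definition cell n x : nat := Num.truncn (x * b%:R ^+ n).

Lemma cellP n x c : 0 <= x ->
  (cell n x == c) = (c%:R / b%:R ^+ n <= x < c.+1%:R / b%:R ^+ n).
Proof.
move=> x0; rewrite ler_pdivrMr // ltr_pdivlMr //; apply/eqP/idP.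
  by move=> <-; apply: truncn_itv; rewrite mulr_ge0 // ltW.
by move/truncn_def.
Qed.

Lemma cell_divn n m x : 0 <= x -> (cell (n + m) x %/ b ^ m)%N = cell n x.
Proof.
move=> x0; apply/esym/eqP; rewrite cellP //.
have /eqP := erefl (cell (n + m) x); rewrite cellP // exprD => /andP[h1 h2].
have bm0 : (0 < b ^ m)%N by rewrite expn_gt0 b_gt0.
rewrite invfM [_^-1 * _]mulrC !mulrA in h1 h2.
apply/andP; split; [apply: le_trans h1|apply: lt_le_trans h2 _];
  rewrite ler_pM2r ?invr_gt0 // ?ler_pdivlMr ?ler_pdivrMr //;
  rewrite -natrX -natrM ler_nat; [exact: leq_divM|exact: ltn_ceil].
Qed.

Lemma cell0 x : 0 <= x < 1 -> cell 0 x = 0%N.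
Proof.
by move=> /andP[x0 x1]; apply/eqP; rewrite cellP // expr0 !divr1 x0 x1.
Qed.

Lemma cell_lt n x : 0 <= x < 1 -> (cell n x < b ^ n)%N.
Proof.
move=> x01; have := cell0 x01; case/andP: x01 => x0 _.
rewrite -(@cell_divn 0 n x) // add0n => /eqP.
by rewrite -leqn0 leqNgt divn_gt0 ?expn_gt0 ?b_gt0 // -ltnNge.
Qed.

Lemma real_digitE x i : real_digit b x i = (cell i x %% b)%N.
Proof. by []. Qed.

Lemma real_digit_lt x i : (real_digit b x i < b)%N.
Proof. by rewrite ltn_mod. Qed.

Lemma eq_cell n m x y : (m <= n)%N -> 0 <= x -> 0 <= y ->
  cell n x = cell n y -> cell m x = cell m y.
Proof.
move=> mn x0 y0 e; rewrite -(cell_divn m (n - m) x0) -(cell_divn m (n - m) y0).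
by rewrite subnKC // e.
Qed.

Lemma cell_left n c : cell n (c%:R / b%:R ^+ n) = c.
Proof.
have h : 0 <= c%:R / b%:R ^+ n :> R by rewrite divr_ge0 // ltW.
by apply/eqP; rewrite cellP // lexx /= ltr_pM2r ?invr_gt0 // ltr_nat.
Qed.

(** Replacing a digit is written as a translation: on the set where the a-th digit is j it is the
    shift by (d - j) / b^a, to which invariance of Lebesgue measure applies. *)
Definition set_digit a d x : R :=
  x + (d%:R - (real_digit b x a)%:R) / b%:R ^+ a.

Section set_digit.
Variables (a d : nat) (x : R).
Hypotheses (a_gt0 : (0 < a)%N) (db : (d < b)%N) (x01 : 0 <= x < 1).
Let y := set_digit a d x.

Let x0 : 0 <= x. Proof. by case/andP: x01. Qed.

Let cell_y : 0 <= y /\ cell a y = (cell a.-1 x * b + d)%N.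
Proof.
have E : cell a x = (cell a.-1 x * b + real_digit b x a)%N.
  by rewrite {1}(divn_eq (cell a x) b) -(cell_divn a.-1 1 x0) addn1 prednK // expn1.
have := eqxx (cell a x); rewrite {2}E cellP // => /andP[h1 h2].
have ys : (cell a.-1 x * b + d)%:R / b%:R ^+ a <= y < (cell a.-1 x * b + d).+1%:R / b%:R ^+ a.
  move: h1 h2; rewrite /y /set_digit -!natr1 !natrD.
  rewrite !ler_pdivrMr // !ltr_pdivlMr // mulrDl divfK ?gt_eqF //.
  by move=> h1 h2; apply/andP; split; lra.
have y0 : 0 <= y by case/andP: ys => + _; apply: le_trans; rewrite divr_ge0 // ltW.
by split => //; apply/eqP; rewrite cellP.
Qed.

Lemma cell_set_digit n : (n < a)%N -> cell n y = cell n x.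
Proof.
case: cell_y => y0 ya na.
have e : cell a.-1 y = cell a.-1 x.
  rewrite -(cell_divn a.-1 1 y0) addn1 prednK // ya expn1 divnMDl //.
  by rewrite divn_small // addn0.
by apply: eq_cell e => //; rewrite -ltnS prednK.
Qed.

Lemma set_digit_itv : 0 <= y < 1.
Proof.
have /eqP := cell_set_digit a_gt0; rewrite (cell0 x01).
by rewrite cellP ?expr0 ?divr1 //; case: cell_y.
Qed.

Lemma real_digit_set_digit : real_digit b y a = d.
Proof. by rewrite real_digitE; case: cell_y => _ ->; rewrite modnMDl modn_small. Qed.

End set_digit.

(** The zero digit of k at position a rules out a carry, so adding kappa there leaves all other
    digits alone. *)
Lemma nat_digit_add k kappa a i : (0 < a)%N -> (0 < i)%N -> (kappa < b)%N ->
  nat_digit b k a = 0%N ->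
  nat_digit b (kappa * b ^ a.-1 + k) i
    = (nat_digit b k i + (if i == a then kappa else 0))%N.
Proof.
rewrite /nat_digit; case: a => // a _; case: i => // i _ /= kb hk; rewrite eqSS.
have bp n : (0 < b ^ n)%N by rewrite expn_gt0 b_gt0.
case: ltngtP => ia.
- rewrite addn0 -(subnK ia) -addSnnS expnD mulnA divnMDl //.
  by rewrite expnSr mulnA modnMDl.
- have [q hq] : exists q, (k %/ b ^ a = q * b)%N by apply/dvdnP/eqP.
  rewrite addn0 -(subnKC ia) expnD expnSr !divnMA divnMDl // hq.
  by rewrite [(kappa + _)%N]addnC divnMDl // mulnK // (divn_small kb) addn0.
- by rewrite -ia in hk *; rewrite divnMDl // -modnDmr hk addn0 add0n modn_small.
Qed.

Lemma nat_digit_small k n i : (k < b ^ n)%N -> (n < i)%N -> nat_digit b k i = 0%N.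
Proof.
move=> kn ni; rewrite /nat_digit divn_small ?mod0n //.
by apply: leq_trans kn _; rewrite leq_exp2l // -ltnS prednK // (leq_ltn_trans _ ni).
Qed.

(** Zero digits contribute nothing to the exponent, so the positions may run over any range that
    covers k. This allows Walsh functions of different indices to be compared over one common
    range. *)
Lemma walshE k n x : (k < b ^ n)%N ->
  walsh b k x = omega R b ^+ (\sum_(a <- iota 1 n) nat_digit b k a * real_digit b x a)%N.
Proof.
move=> kn; congr (_ ^+ _).
rewrite /expansion_of big_map big_filter big_mkcond /=.
transitivity (\sum_(a <- iota 1 k) nat_digit b k a * real_digit b x a)%N.
  rewrite (perm_big (iota 1 k)) /=; last by rewrite perm_rev.
  by apply: eq_bigr => a _; case: eqP => // ->; rewrite mul0n.
have H m p : (k < b ^ m)%N ->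
    (\sum_(a <- iota 1 (m + p)) nat_digit b k a * real_digit b x a
     = \sum_(a <- iota 1 m) nat_digit b k a * real_digit b x a)%N.
  move=> km; rewrite iotaD big_cat /= [X in (_ + X)%N]big1_seq ?addn0 // => i /=.
  by rewrite mem_iota => /andP[h _]; rewrite (nat_digit_small km).
have kk : (k < b ^ k)%N := ltn_expl k hb.
by have := H k n kk; rewrite (addnC k n) => <-; exact: H.
Qed.

Lemma walsh_add k kappa a x : (0 < a)%N -> (kappa < b)%N ->
  nat_digit b k a = 0%N ->
  walsh b (kappa * b ^ a.-1 + k) x
    = omega R b ^+ (kappa * real_digit b x a) * walsh b k x.
Proof.
move=> a0 kb hk; pose n := (kappa * b ^ a.-1 + k + a)%N.
have h m : (m < b ^ m)%N by rewrite ltn_expl.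
rewrite (@walshE _ n) ?(@walshE k n).
- rewrite -exprD; congr (_ ^+ _).
  rewrite [LHS](eq_big_seq (fun i => nat_digit b k i * real_digit b x i +
     (if i == a then kappa * real_digit b x i else 0))%N); last first.
    move=> i; rewrite mem_iota => /andP[i0 _].
    by rewrite nat_digit_add // mulnDl; case: eqP.
  rewrite big_split addnC /=; congr (_ + _)%N.
  rewrite -big_mkcond -big_filter /= (_ : [seq _ <- _ | _] = [:: a]) ?big_seq1 //.
  have -> : [seq i <- iota 1 n | i == a] = [seq i <- iota 1 n | pred1 a i] by [].
  by rewrite filter_pred1_uniq ?iota_uniq // mem_iota a0 /n; lia.
- by apply: leq_ltn_trans (h n); rewrite /n; lia.
- by apply: leq_ltn_trans (h n); rewrite /n; lia.
Qed.

(** Only the first n digits of x enter, so [walsh b k] is a step function on b-adic intervals. Its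
    measurability and boundedness come from this. *)
Lemma walsh_cell k n x : (k < b ^ n)%N -> 0 <= x ->
  walsh b k x = walsh b k ((cell n x)%:R / b%:R ^+ n).
Proof.
move=> kn x0; rewrite !(walshE _ kn); congr (_ ^+ _).
apply: eq_big_seq => i; rewrite mem_iota => /andP[i1 i2].
have y0 : 0 <= (cell n x)%:R / b%:R ^+ n :> R by rewrite divr_ge0 // ltW.
by rewrite !real_digitE (@eq_cell n i _ ((cell n x)%:R / b%:R ^+ n)) ?cell_left.
Qed.

Lemma walsh0 x : walsh b 0 x = 1.
Proof. by rewrite (@walshE 0 0) // big_nil. Qed.

Lemma expansion_val_cons kappa a (e : seq (nat * nat)) :
  expansion_val b ((kappa, a) :: e) = (kappa * b ^ a.-1 + expansion_val b e)%N.
Proof. by rewrite /expansion_val big_cons. Qed.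

(** This makes every position above the leading exponent a zero digit, hence free for the next term
    of the expansion. *)
Lemma expansion_val_lt (e : seq (nat * nat)) :
  is_expansion b e -> (expansion_val b e < b ^ lead_exp e)%N.
Proof.
elim: e => [_|[kappa a] e IH]; first by rewrite /expansion_val big_nil.
rewrite /is_expansion /= => /andP[/andP[/andP[/andP[k0 kb] /= a0] he]].
rewrite path_sortedE; last by move=> x y z /= h1 h2; exact: ltn_trans h2 h1.
case/andP=> hlt hs; rewrite expansion_val_cons /lead_exp /=.
have le : (lead_exp e <= a.-1)%N.
  rewrite /lead_exp; case: (unzip2 e) hlt => //= c l /andP[ca _].
  by rewrite -ltnS prednK.
apply: (@leq_trans (kappa.+1 * b ^ a.-1)%N).
  rewrite mulSn addnC ltn_add2r; apply: leq_trans (IH _) _; first exact/andP.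
  by rewrite leq_exp2l.
by rewrite -{2}(prednK a0) expnS leq_mul2r kb orbT.
Qed.

End Digits.

(** * The root of unity *)

Section Omega.
Variables (R : realType) (b : nat).
Hypothesis hb : (1 < b)%N.
Local Notation w := (omega R b).

Let b_gt0 : (0 < b)%N. Proof. exact: ltnW. Qed.

Lemma omegaX n : w ^+ n =
  Complex (cos (2%:R * pi / b%:R * n%:R)) (sin (2%:R * pi / b%:R * n%:R)).
Proof.
elim: n => [|n IH]; first by rewrite expr0 mulr0 cos0 sin0.
rewrite exprSr IH /omega; set t := 2%:R * pi / b%:R.
rewrite (_ : t * n.+1%:R = t * n%:R + t) ?cosD ?sinD; last first.
  by rewrite -(natr1 n) mulrDr mulr1.
by apply/eqP; rewrite eq_complex /= !eqxx addrC eqxx.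
Qed.

(** If omega^n = 1 then cos(2t) = 1 with t = pi n / b, so sin t = 0; but 0 < t < pi when 0 < n <
    b. *)
Lemma omega_primitive : b.-primitive_root w.
Proof.
rewrite /primitive_root_of_unity b_gt0 /=; apply/forallP => -[i ib] /=.
have b0 : 0 < b%:R :> R by rewrite ltr0n.
apply/eqP; rewrite unity_rootE; apply/eqP/eqP => [|->]; last first.
  rewrite omegaX divfK ?gt_eqF // mulrC mulr_natr cos2pi sin2pi.
  by apply/eqP; rewrite eq_complex /= !eqxx.
rewrite omegaX => -[/eqP + _]; pose t : R := pi / b%:R * i.+1%:R.
rewrite (_ : 2%:R * pi / _ * _ = t *+ 2) => [h|]; last first.
  by rewrite /t -mulr_natr; ring.
have ht : 2 * sin t ^+ 2 = 0.
  have := cos2Dsin2 t; have := cos_mulr2n t; rewrite (eqP h) => h1 h2; lra.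
have t0 : 0 < t by rewrite mulr_gt0 ?ltr0n // divr_gt0 ?pi_gt0.
apply/eqP; rewrite eqn_leq ib /= leqNgt; apply/negP => ib'.
have tpi : t < pi.
  by rewrite /t -mulrA gtr_pMr ?pi_gt0 // mulrC ltr_pdivrMr // mul1r ltr_nat.
have : 0 < 2 * sin t ^+ 2 by rewrite mulr_gt0 // exprn_gt0 // sin_gt0_pi ?t0.
by rewrite ht ltxx.
Qed.

Lemma omega_conj_mul : w * w^* = 1.
Proof.
apply/eqP; rewrite /omega eq_complex /=; apply/andP; split; apply/eqP; last lra.
by have := cos2Dsin2 (2%:R * pi / b%:R :> R); rewrite !expr2; lra.
Qed.

Lemma sum_unity_root (z : R[i]) : z ^+ b = 1 -> z != 1 ->
  \sum_(d < b) z ^+ d = 0.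
Proof.
move=> zb z1; apply/(mulfI (_ : z - 1 != 0)); first by rewrite subr_eq0.
by rewrite mulr0 -subrX1 zb subrr.
Qed.

Lemma omega_conj_neq1 kappa : (0 < kappa < b)%N -> (w^* ^+ kappa) != 1.
Proof.
move=> /andP[k0 kb]; rewrite -rmorphXn /=; apply/negP => /eqP/(congr1 Num.conj).
rewrite conjCK rmorph1 => /eqP; rewrite -(prim_order_dvd omega_primitive).
by move/(dvdn_leq k0); rewrite leqNgt kb.
Qed.

Lemma omega_conj_unity kappa : (w^* ^+ kappa) ^+ b = 1.
Proof.
by rewrite exprAC -rmorphXn /= (prim_expr_order omega_primitive) rmorph1 expr1n.
Qed.

Lemma sum_omega_conj kappa : (0 < kappa < b)%N -> \sum_(d < b) w^* ^+ (kappa * d) = 0.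
Proof.
move=> hk; under eq_bigr do rewrite exprM.
by apply: sum_unity_root; [exact: omega_conj_unity|exact: omega_conj_neq1].
Qed.

(* The constant by which differentiation multiplies the limit:
   b^(2a-1) times the integral of x conj(omega^(kappa x_a)) over an interval
   [m b^(1-a), (m+1) b^(1-a)[. *)
Definition slope kappa : R[i] := b%:R^-1 * \sum_(d < b) d%:R * w^* ^+ (kappa * d).

(** Summation by parts with z = conj(omega)^kappa: since z^b = 1 and the powers of z sum to 0, (z -
    1) times the sum of d z^d equals b. *)
Lemma slope_neq0 kappa : (0 < kappa < b)%N -> slope kappa != 0.
Proof.
move=> hk; have b0 : b%:R != 0 :> R[i] by rewrite pnatr_eq0 -lt0n.
rewrite mulf_neq0 ?invr_eq0 //; under eq_bigr do rewrite exprM.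
set z := w^* ^+ kappa.
have E n : (z - 1) * \sum_(d < n) d%:R * z ^+ d
    = n%:R * z ^+ n - z * \sum_(d < n) z ^+ d.
  elim: n => [|n IH]; first by rewrite !big_ord0 !mulr0 mul0r subrr.
  by rewrite !big_ord_recr /= !mulrDr IH exprS -natr1; ring.
apply: contra b0 => /eqP h; have := E b.
by rewrite h mulr0 omega_conj_unity sum_unity_root ?omega_conj_unity
  ?omega_conj_neq1 // mulr0 subr0 mulr1 => <-.
Qed.

(** For x different from d, the product of omega^d and conj(omega)^x is a b-th root of unity other
    than 1, so its powers sum to 0. The lemma later expresses the indicator of one digit value by
    Walsh functions. *)
Lemma omega_orthogonal d x : (d < b)%N -> (x < b)%N ->
  \sum_(k < b) w ^+ (k * d) * w^* ^+ (k * x) = (if x == d then b else 0)%:R.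
Proof.
move=> db xb; have E k : w ^+ (k * d) * w^* ^+ (k * x) = (w ^+ d * w^* ^+ x) ^+ k.
  by rewrite exprMn -!exprM mulnC [(x * k)%N]mulnC.
under eq_bigr do rewrite E.
case: eqP => [->|xd].
  rewrite -exprMn omega_conj_mul expr1n.
  by under eq_bigr do rewrite expr1n; rewrite sumr_const card_ord.
apply: sum_unity_root.
  by rewrite exprMn !(exprAC _ _ b) -rmorphXn /=
    (prim_expr_order omega_primitive) rmorph1 !expr1n mul1r.
apply/negP => /eqP h; apply: xd.
have /eqP : w ^+ d = w ^+ x.
  by rewrite -[LHS]mulr1 -(expr1n _ x) -omega_conj_mul exprMn mulrCA h mulr1.
rewrite (eq_prim_root_expr omega_primitive) !modn_small //.
by move/eqP.
Qed.

End Omega.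

(** * Bounded measurable functions on the unit interval *)

Section BoundedMeasurable.
Variable R : realType.
Local Notation mu := (@lebesgue_measure R).
Local Notation I := (`[0%R, 1%R[%classic : set R).
Implicit Types (f g : R -> R) (x y u v : R).

Definition bounded_measurable f : Prop :=
  measurable_fun I f /\ exists M : R, forall x : R, 0 <= x < 1 -> `|f x| <= M.

Lemma unit_itvP x : I x = (0 <= x < 1) :> Prop.
Proof. by rewrite /= in_itv. Qed.

Lemma measurable_unit_itv : measurable I.
Proof. exact: measurable_itv. Qed.

Lemma bounded_measurable_integrable f (A : set R) : bounded_measurable f ->
  measurable A -> A `<=` I -> mu.-integrable A (EFin \o f).
Proof.
move=> [mf [M hM]] mA AI; apply: (@integrableS _ _ _ mu I) => //.
apply: measurable_bounded_integrable => //.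
   by rewrite /= lebesgue_measure_itv /= lte_fin ltr01 oppr0 adde0 ltry.
exists M; split; first exact: num_real.
by move=> N MN x; rewrite /= in_itv /= => hx; exact: le_trans (hM x hx) (ltW MN).
Qed.

Lemma bounded_measurable_cst (c : R) : bounded_measurable (fun=> c).
Proof. by split; [exact: measurable_cst|exists `|c|]. Qed.

Lemma bounded_measurableD f g : bounded_measurable f -> bounded_measurable g ->
  bounded_measurable (fun x => f x + g x).
Proof.
move=> [mf [M hM]] [mg [N hN]]; split; first exact: measurable_funD.
by exists (M + N) => x hx; rewrite (le_trans (ler_normD _ _)) // lerD ?hM ?hN.
Qed.

Lemma bounded_measurableM f g : bounded_measurable f -> bounded_measurable g ->
  bounded_measurable (fun x => f x * g x).
Proof.
move=> [mf [M hM]] [mg [N hN]]; split; first exact: measurable_funM.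
by exists (M * N) => x hx; rewrite normrM ler_pM ?hM ?hN.
Qed.

Lemma bounded_measurable_sum n (F : 'I_n -> R -> R) :
  (forall i, bounded_measurable (F i)) ->
  bounded_measurable (fun x => \sum_(i < n) F i x).
Proof.
elim: n F => [F _|n IH F hF].
  under eq_fun do rewrite big_ord0; exact: bounded_measurable_cst.
under eq_fun do rewrite big_ord_recr /=.
by apply: bounded_measurableD => //; exact: IH.
Qed.

Lemma eq_unit_Rintegral f g : (forall x, 0 <= x < 1 -> f x = g x) ->
  \int[mu]_(x in I) f x = \int[mu]_(x in I) g x.
Proof. by move=> fg; apply: eq_Rintegral => x; rewrite inE unit_itvP => /fg. Qed.

Lemma unit_RintegralD f g : bounded_measurable f -> bounded_measurable g ->
  \int[mu]_(x in I) (f x + g x) = \int[mu]_(x in I) f x + \int[mu]_(x in I) g x.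
Proof.
by move=> hf hg; apply: RintegralD => //; exact: bounded_measurable_integrable.
Qed.

Lemma unit_RintegralZ f (c : R) : bounded_measurable f ->
  \int[mu]_(x in I) (c * f x) = c * \int[mu]_(x in I) f x.
Proof.
by move=> hf; apply: RintegralZl => //; exact: bounded_measurable_integrable.
Qed.

Lemma unit_Rintegral_sum n (F : 'I_n -> R -> R) :
  (forall i, bounded_measurable (F i)) ->
  \int[mu]_(x in I) (\sum_(i < n) F i x) = \sum_(i < n) \int[mu]_(x in I) F i x.
Proof.
elim: n F => [F _|n IH F hF].
  under eq_Rintegral do rewrite big_ord0.
  by rewrite big_ord0 Rintegral_cst // mul0r.
under eq_Rintegral do rewrite big_ord_recr /=.
rewrite unit_RintegralD //; last exact: bounded_measurable_sum.
by rewrite big_ord_recr IH.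
Qed.

(** The image measure under translation gives half-open intervals their length, and these values
    determine Lebesgue measure. *)
Lemma lebesgue_measure_translate (t : R) (A : set R) : measurable A ->
  mu A = mu ((fun x => x + t) @^-1` A).
Proof.
have mt : measurable_fun setT (fun x : R => x + t) by exact: measurable_funD.
move=> mA; rewrite -[RHS]/(pushforward mu (fun x => x + t) A).
have mt' : measurable_fun (setT : set (measurableTypeR R))
  ((fun x : R => x + t) : measurableTypeR R -> measurableTypeR R) := mt.
apply: (@lebesgue_measure_unique R
  (measure_function_pushforward__canonical__measure_function_Measure
    (@lebesgue_measure R) mt')) => //.
move=> X [[u v] /= _ <-]; rewrite /pushforward.
rewrite (_ : _ @^-1` _ = `]u - t, v - t]%classic); last first.
  by apply/seteqP; split => x /=; rewrite !in_itv /= ltrBlDr lerBrDr.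
rewrite /= !lebesgue_measure_itv /= !lte_fin ltrD2r.
by case: ifP => // _; congr EFin; lra.
Qed.

Lemma Rintegral_translate (A B : set R) f (t : R) : bounded_measurable f ->
    measurable A -> A `<=` I -> B `<=` I ->
    (fun x => x + t) @^-1` A = B ->
  \int[mu]_(x in A) f x = \int[mu]_(x in B) f (x + t).
Proof.
move=> [mf [M hM]] mA AI BI AB.
have mt : measurable_fun setT (fun x : R => x + t) by exact: measurable_funD.
have mB : measurable B by rewrite -AB -[X in measurable X]setTI; exact: mt.
(* Extended by 0 outside A, f becomes measurable on the whole line and can be composed with the
   translation. *)
pose F := f \_ A.
have mF : measurable_fun setT F.
  by apply/(measurable_restrictT _ mA); exact: measurable_funS mf.
have hF x : `|F x| <= `|M|.
  rewrite /F /restrict; case: ifP => [/set_mem/AI|_]; last by rewrite normr0.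
  by rewrite unit_itvP => /hM h; exact: le_trans h (ler_norm _).
have mFt : measurable_fun setT (F \o (fun x : R => x + t)).
  exact: measurableT_comp.
have iF : mu.-integrable B (EFin \o (F \o (fun x : R => x + t))).
  apply: bounded_measurable_integrable => //.
  by split; [exact: measurable_funS mFt|exists `|M| => x _; exact: hF].
rewrite (_ : \int[mu]_(x in A) f x = \int[mu]_(x in A) F x); last first.
  by apply: eq_Rintegral => x xA; rewrite /F /restrict xA.
have mt' : measurable_fun (setT : set (measurableTypeR R))
  ((fun x : R => x + t) : measurableTypeR R -> measurableTypeR R) := mt.
have e : \int[mu]_(x in A) F x = \int[mu]_(x in B) F (x + t).
  rewrite /Rintegral; congr fine.
  have := @eq_measure_integral _ (measurableTypeR R) R A
    (measure_function_pushforward__canonical__measure_function_Measure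
      (@lebesgue_measure R) mt') (@lebesgue_measure R) (EFin \o F).
  move=> -> //; last by move=> C mC _; exact: lebesgue_measure_translate.
  rewrite (integral_pushforward mt') //; first by rewrite AB.
  - exact/measurable_EFinP.
  - by rewrite AB.
rewrite e; apply: eq_Rintegral => x; rewrite inE -AB /= => xA.
by rewrite /F /restrict mem_set.
Qed.

Section Digits.
Variable b : nat.
Hypothesis hb : (1 < b)%N.

Let bn_gt0 n : 0 < b%:R ^+ n :> R. Proof. by rewrite exprn_gt0 // ltr0n ltnW. Qed.

Lemma measurable_cell_eq n c :
  measurable (I `&` [set x | cell b n x = c]).
Proof.
rewrite (_ : _ `&` _ = I `&` `[c%:R / b%:R ^+ n, c.+1%:R / b%:R ^+ n[%classic).
  exact: measurableI.
apply/seteqP; split => x [] /=; rewrite !in_itv /= => x01.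
  by move=> /eqP; rewrite (cellP hb); [|case/andP: x01].
by rewrite -(cellP hb) => [/eqP|]; [|case/andP: x01].
Qed.

Lemma bounded_measurable_cell n (psi : nat -> R) :
  bounded_measurable (fun x => psi (cell b n x)).
Proof.
split; last first.
  exists (\sum_(c < b ^ n) `|psi c|) => x hx.
  by rewrite (bigD1 (Ordinal (cell_lt hb n hx))) //= lerDl sumr_ge0.
move=> _ Y mY; rewrite (_ : _ `&` _ =
    \bigcup_(c in [set c | Y (psi c)]) (I `&` [set x | cell b n x = c])).
  by apply: bigcup_measurable => c _; exact: measurable_cell_eq.
apply/seteqP; split => [x [hx hY]|x [c /= hc [hx hxc]]].
  by exists (cell b n x).
by split=> //=; rewrite hxc.
Qed.

Lemma bounded_measurable_digit a (psi : nat -> R) :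
  bounded_measurable (fun x => psi (real_digit b x a)).
Proof. exact: (bounded_measurable_cell a (fun c => psi (c %% b)%N)). Qed.

Lemma bounded_measurable_set_digit a d f : (0 < a)%N -> (d < b)%N ->
  bounded_measurable f -> bounded_measurable (fun x => f (set_digit b a d x)).
Proof.
move=> a0 db [mf [M hM]]; split; last first.
  by exists M => x hx; apply: hM; exact: set_digit_itv.
apply: (measurable_comp _ _ mf) => //.
  by move=> _ [x + <-]; rewrite !unit_itvP => hx; exact: set_digit_itv.
apply: measurable_funD => //.
have [] := bounded_measurable_digit a (fun c => (d%:R - c%:R) / b%:R ^+ a).
by [].
Qed.

(** The set where the a-th digit is d is a translate of each set where it is j, and [set_digit] is
    that translation. Summing the b equal integrals over j covers the unit interval once, whence the
    factor 1/b. *)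
Lemma Rintegral_set_digit a d f : (0 < a)%N -> (d < b)%N -> bounded_measurable f ->
  \int[mu]_(x in I) ((real_digit b x a == d)%:R * f x)
    = b%:R^-1 * \int[mu]_(x in I) f (set_digit b a d x).
Proof.
move=> a0 db hf; pose E j := I `&` [set x | real_digit b x a = j].
have hind j g : bounded_measurable g ->
    bounded_measurable (fun x => (real_digit b x a == j)%:R * g x).
  apply: bounded_measurableM.
  exact: (bounded_measurable_digit a (fun c => (c == j)%:R)).
have mE j : measurable (E j).
  (* [E j] is the preimage of 1 under the indicator of the digit value j. *)
  have [/(_ measurable_unit_itv [set 1%R] (measurable_set1 _)) + _] :=
    bounded_measurable_digit a (fun c => (c == j)%:R : R).
  congr (measurable (_ `&` _)); apply/seteqP; split => x /=.
    by case: eqP => // _ /eqP; rewrite eq_sym oner_eq0.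
  by move=> ->; rewrite eqxx.
have intE j g : \int[mu]_(x in E j) g x = \int[mu]_(x in I) ((real_digit b x a == j)%:R * g x).
  rewrite Rintegral_mkcondr; apply: eq_Rintegral => x _.
  rewrite /restrict; case: eqP => h; last by rewrite memNset ?mul0r.
  by rewrite mem_set // mul1r.
have shift j : (j < b)%N ->
    \int[mu]_(x in E d) f x = \int[mu]_(x in E j) f (set_digit b a d x).
  move=> jb; rewrite (Rintegral_translate (B := E j) (t := (d%:R - j%:R) / b%:R ^+ a) hf) //.
  - by apply: eq_Rintegral => x; rewrite inE => -[_ /= <-].
  - by move=> x [].
  - by move=> x [].
  - apply/seteqP; split => x; rewrite /E /setI /= !in_itv /= => -[hx hd].
      have := set_digit_itv hb a0 jb hx; have := real_digit_set_digit hb a0 jb hx.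
      rewrite /set_digit hd.
      rewrite (_ : _ + (j%:R - d%:R) / _ = x) //.
      by rewrite -addrA -mulrDl addrA subrK subrr mul0r addr0.
    have := set_digit_itv hb a0 db hx; have := real_digit_set_digit hb a0 db hx.
    by rewrite /set_digit hd.
have b0 : b%:R != 0 :> R by rewrite pnatr_eq0 -lt0n ltnW.
rewrite -intE; apply: (mulfI b0); rewrite mulrA divff // mul1r.
transitivity (\sum_(j < b) \int[mu]_(x in E j) f (set_digit b a d x)).
  rewrite (eq_bigr (fun=> \int[mu]_(x in E d) f x)).
    by rewrite sumr_const card_ord mulr_natl.
  by move=> j _; rewrite -shift.
under eq_bigr do rewrite intE.
rewrite -unit_Rintegral_sum => [|j]; last first.
  by apply: hind; exact: bounded_measurable_set_digit.
apply: eq_unit_Rintegral => x hx.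
rewrite -mulr_suml (bigD1 (Ordinal (real_digit_lt hb x a))) //= eqxx.
rewrite big1 ?addr0 ?mul1r // => j /eqP hj; case: eqP => // e.
by case: hj; apply: val_inj.
Qed.

End Digits.
End BoundedMeasurable.

(** * Derivatives on [0, 1] *)

Section UnitDerivative.
Variable R : realType.
Local Notation mu := (@lebesgue_measure R).
Local Notation I := (`[0%R, 1%R[%classic : set R).
Implicit Types (f g : R -> R) (x y u v : R).

(** Multiplied out, the estimate also holds at y = x, so later steps need not exclude this point.
    One-sided derivatives at 0 and 1 are included. *)
Lemma deriv_on01P f g x : deriv_on01 f g -> 0 <= x <= 1 ->
  forall e : R, 0 < e -> exists2 d : R, 0 < d & forall y, 0 <= y <= 1 ->
    `|y - x| < d -> `|f y - f x - g x * (y - x)| <= e * `|y - x|.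
Proof.
move=> fg x01 e e0; have /cvgrPdist_le/(_ e e0) := fg x x01.
rewrite near_withinE /= => /nbhs_ballP[d /= d0 hd].
exists d => // y y01 yx; have [->|yNx] := eqVneq y x.
  by rewrite !subrr mulr0 subrr normr0 mulr0.
have := hd y _ yNx; rewrite /ball /= distrC in_itv /= y01 => /(_ yx isT).
have n0 : 0 < `|y - x| by rewrite normr_gt0 subr_eq0.
rewrite -(ler_pM2r n0) -normrM mulrBl divfK ?subr_eq0 //.
by rewrite -normrN opprB.
Qed.

Lemma deriv_on01_continuous f g : deriv_on01 f g -> {within `[0, 1], continuous f}.
Proof.
move=> fg; apply/subspace_continuousP => x; rewrite /= in_itv /= => x01.
apply/cvgrPdist_le => e e0; rewrite near_withinE.
have [d d0 hd] := deriv_on01P fg x01 ltr01.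
apply/nbhs_ballP; pose m := 1 + `|g x|.
have m0 : 0 < m by rewrite ltr_pwDl.
exists (Num.min d (e / m)); first by rewrite /= lt_min d0 divr_gt0.
move=> y; rewrite /ball /= distrC lt_min => /andP[yd ye].
rewrite in_itv /= => y01; rewrite distrC.
have := hd y y01 yd; rewrite mul1r => h.
have -> : f y - f x = (f y - f x - g x * (y - x)) + g x * (y - x) by ring.
apply: le_trans (ler_normD _ _) _; rewrite normrM.
rewrite ltr_pdivlMr // in ye; rewrite /m in ye.
by lra.
Qed.

Lemma deriv_on01_is_derive f g x : deriv_on01 f g -> 0 < x < 1 ->
  is_derive x 1 f (g x).
Proof.
move=> fg /andP[x0 x1]; have x01 : 0 <= x <= 1 by rewrite !ltW.
have H : h^-1 *: ((f \o shift x) (h *: 1) - f x) @[h --> 0^'] --> g x.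
  apply/cvgrPdist_le => e e0; have [d d0 hd] := deriv_on01P fg x01 e0.
  apply/nbhs_ballP.
  exists (Num.min d (Num.min x (1 - x))); first by rewrite /= !lt_min d0 x0 subr_gt0.
  move=> h; rewrite /ball /= sub0r normrN !lt_min => /and3P[hdd hx h1x] h0.
  have hx' : `|h + x - x| = `|h| by rewrite addrK.
  have := hd (h + x); rewrite hx' => /(_ _ hdd); rewrite addrK => hh.
  have n0 : 0 < `|h| by rewrite normr_gt0.
  suff : `|g x - h^-1 * (f (h + x) - f x)| <= e.
    by rewrite /= -[h *: 1]/(h * 1) mulr1.
  rewrite -(ler_pM2r n0) -normrM mulrBl mulrAC mulVf // mul1r distrC; apply: hh.
  by move: hx h1x; rewrite !ltr_norml => /andP[? ?] /andP[? ?]; apply/andP; split; lra.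
by split; [apply: cvgP H|apply: cvg_lim H].
Qed.

Lemma deriv_on01_MVT f g u v : deriv_on01 f g -> 0 <= u -> u <= v -> v <= 1 ->
  exists2 c, 0 <= c <= 1 & f v - f u = g c * (v - u).
Proof.
move=> fg u0 uv v1.
have [||c cuv ->] := @MVT_segment _ f g u v uv.
- move=> x; rewrite in_itv /= => /andP[ux xv]; apply: deriv_on01_is_derive => //.
  by rewrite (le_lt_trans u0 ux) (lt_le_trans xv v1).
- apply: continuous_subspaceW (deriv_on01_continuous fg).
  by move=> x /=; rewrite !in_itv /= => /andP[ux xv]; rewrite (le_trans u0) // (le_trans xv).
- exists c => //; move: cuv; rewrite in_itv /= => /andP[ux xv].
  by rewrite (le_trans u0) // (le_trans xv).
Qed.

Lemma deriv_on01_lipschitz f g (M : R) : deriv_on01 f g ->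
  (forall x : R, 0 <= x <= 1 -> `|g x| <= M) ->
  forall x y, 0 <= x <= 1 -> 0 <= y <= 1 -> `|f x - f y| <= M * `|x - y|.
Proof.
move=> fg gM x y; wlog xy : x y / y <= x => [H|] x01 y01.
  have [/H|/ltW/H] := leP y x; first exact.
  by move=> /(_ y01 x01) h; rewrite distrC [`|x - y|]distrC.
case/andP: x01 => _ x1; case/andP: y01 => y0 _.
have [c c01 ->] := deriv_on01_MVT fg y0 xy x1.
by rewrite normrM ler_wpM2r // gM.
Qed.

Lemma deriv_on01_bounded f g (M : R) : deriv_on01 f g ->
  (forall x : R, 0 <= x <= 1 -> `|g x| <= M) ->
  exists N : R, forall x : R, 0 <= x <= 1 -> `|f x| <= N.
Proof.
move=> fg gM; exists (`|f 0| + M) => x x01.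
have z01 : 0 <= (0 : R) <= 1 by rewrite lexx ler01.
have M0 : 0 <= M by apply: le_trans (gM 0 z01).
have := deriv_on01_lipschitz fg gM x01 z01; rewrite subr0 => h.
rewrite -[f x](subrK (f 0)); apply: le_trans (ler_normD _ _) _.
rewrite addrC lerD2l (le_trans h) // ler_piMr // ger0_norm //; by case/andP: x01.
Qed.

(** Measurability and boundedness of the limit belong to the conclusion: this is how a derivative is
    found to be measurable. *)
Lemma unit_dominated_convergence (h_ : nat -> R -> R) (h : R -> R) (C : R) :
  (forall n, bounded_measurable (h_ n)) ->
  (forall n (x : R), 0 <= x < 1 -> `|h_ n x| <= C) ->
  (forall x : R, 0 <= x < 1 -> h_ n x @[n --> \oo] --> h x) ->
  bounded_measurable h /\
  forall A : set R, measurable A -> A `<=` I ->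
    \int[mu]_(x in A) h_ n x @[n --> \oo] --> \int[mu]_(x in A) h x.
Proof.
move=> mh_ hC hcvg.
have hh : bounded_measurable h.
  split; last first.
    exists C => x hx; have hn : `|h_ n x| @[n --> \oo] --> `|h x| by apply: cvg_norm; exact: hcvg.
    rewrite -(cvg_lim (@Rhausdorff R) hn).
    by apply: limr_le; [exact: (cvgP _ hn)|apply: nearW => n; exact: hC].
  apply: (@measurable_fun_cvg _ _ R I h_) => [n|x]; first by case: (mh_ n).
  by rewrite unit_itvP; exact: hcvg.
split=> // A mA AI.
have [] := @dominated_convergence _ _ R mu A mA (fun n => EFin \o h_ n) (EFin \o h)
  (EFin \o cst C).
- move=> n; have /integrableP[] // := bounded_measurable_integrable (mh_ n) mA AI.
- by have /integrableP[] // := bounded_measurable_integrable hh mA AI.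
- apply: aeW => x /AI; rewrite unit_itvP => hx; apply: cvg_EFin; first exact: nearW.
  exact: hcvg.
- exact: bounded_measurable_integrable (bounded_measurable_cst C) mA AI.
- by apply: aeW => x n /AI; rewrite unit_itvP => hx; rewrite /= lee_fin hC.
move=> _ _ H; rewrite /Rintegral.
apply: (@fine_cvg _ _ _ _ (fun n => \int[mu]_(x in A) (h_ n x)%:E)%E).
rewrite fineK //; apply: integrable_fin_num => //.
exact: bounded_measurable_integrable hh mA AI.
Qed.

Lemma lipschitz_bounded_measurable f (M : R) :
  (forall x y, `|f x - f y| <= M * `|x - y|) -> bounded_measurable f.
Proof.
move=> fM.
have M0 : 0 <= M.
  by have := le_trans (normr_ge0 _) (fM 1 0); rewrite subr0 normr1 mulr1.
split.
  apply: (@measurable_funS _ _ _ _ setT) => //; apply: continuous_measurable_fun => x.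
  apply/cvgrPdist_le => e e0; apply/nbhs_ballP; exists (e / (M + 1)).
    by rewrite /= divr_gt0 // ltr_wpDl.
  move=> y; rewrite /ball /= ltr_pdivlMr ?ltr_wpDl // => h.
  by apply: le_trans (fM _ _) _; have := normr_ge0 (x - y); lra.
exists (`|f 0| + M) => x /andP[x0 x1].
have := fM x 0; rewrite subr0 [`|x|]ger0_norm // => h.
rewrite -[f x](subrK (f 0)); apply: le_trans (ler_normD _ _) _.
by rewrite addrC lerD2l (le_trans h) // ler_piMr // ltW.
Qed.

(** Extending f by its endpoint values keeps the Lipschitz constant and gives meaning to f(x + t)
    when x + t leaves the unit interval. *)
Definition clamp f x : R := f (Num.max 0 (Num.min x 1)).

Lemma clampE f x : 0 <= x <= 1 -> clamp f x = f x.
Proof. by case/andP=> x0 x1; rewrite /clamp min_l // max_r. Qed.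

Lemma clamp_lipschitz f (M : R) :
  (forall x y, 0 <= x <= 1 -> 0 <= y <= 1 -> `|f x - f y| <= M * `|x - y|) ->
  forall x y, `|clamp f x - clamp f y| <= M * `|x - y|.
Proof.
move=> fM x y; have c01 (z : R) : 0 <= Num.max 0 (Num.min z 1) <= 1.
  by rewrite le_max lexx /= ge_max ler01 ge_min lexx orbT.
have M0 : 0 <= M.
  have := le_trans (normr_ge0 _) (fM 1 0 _ _); rewrite subr0 normr1 mulr1.
  by apply; rewrite ?lexx ?ler01.
apply: le_trans (fM _ _ (c01 x) (c01 y)) _; rewrite ler_wpM2l //.
have le_abs (p q : R) : p <= q -> - q <= p -> `|p| <= q by rewrite ler_norml => -> ->.
have le_max (a c : R) : `|Num.max 0 a - Num.max 0 c| <= `|a - c|.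
  have := ler_norm (a - c); have := ler_norm (c - a); rewrite distrC.
  by case: (leP 0 a) => ?; case: (leP 0 c) => ? ? ?; apply: le_abs; lra.
apply: le_trans (le_max _ _) _.
have := ler_norm (x - y); have := ler_norm (y - x); rewrite distrC.
by case: (leP x 1) => ?; case: (leP y 1) => ? ? ?; apply: le_abs; lra.
Qed.

(** * The fundamental theorem of calculus for a bounded derivative *)

Section BoundedDerivative.
Variables (f g : R -> R) (M : R).
Hypothesis fg : deriv_on01 f g.
Hypothesis gM : forall x : R, 0 <= x <= 1 -> `|g x| <= M.
Local Notation F := (clamp f).

Let F_lip x y : `|F x - F y| <= M * `|x - y|.
Proof. by apply: clamp_lipschitz; exact: deriv_on01_lipschitz fg gM. Qed.

Let M0 : 0 <= M.
Proof. by apply: le_trans (gM (x := 0) _); rewrite ?lexx ?ler01. Qed.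

Lemma bounded_measurable_clamp : bounded_measurable F.
Proof. exact: lipschitz_bounded_measurable F_lip. Qed.

Lemma bounded_measurable_primitive : bounded_measurable f.
Proof.
have [mF [N hN]] := bounded_measurable_clamp; split.
  apply: eq_measurable_fun mF => x; rewrite inE unit_itvP => /andP[x0 x1].
  by rewrite clampE // x0 ltW.
exists N => x hx; have /andP[x0 x1] := hx.
by rewrite -(clampE f (x := x)); [exact: hN|rewrite x0 ltW].
Qed.

Let quot (t : R) x := t^-1 * (F (x + t) - F x).

Let bm_quot t : bounded_measurable (quot t).
Proof.
apply: bounded_measurableM; first exact: bounded_measurable_cst.
apply: bounded_measurableD.
  apply: (@lipschitz_bounded_measurable _ M) => x y.
  by apply: le_trans (F_lip _ _) _; rewrite opprD addrACA subrr addr0.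
apply: (@lipschitz_bounded_measurable _ M) => x y.
by rewrite opprK addrC distrC.
Qed.

Let quot_le t x : 0 < t -> `|quot t x| <= M.
Proof.
move=> t0; rewrite /quot normrM gtr0_norm ?invr_gt0 // mulrC ler_pdivrMr //.
by apply: le_trans (F_lip _ _) _; rewrite addrAC subrr add0r gtr0_norm.
Qed.

Let quot_cvg (t : nat -> R) x : (forall n, 0 < t n) -> t n @[n --> \oo] --> 0 ->
  0 <= x < 1 -> quot (t n) x @[n --> \oo] --> g x.
Proof.
move=> tp t0 /andP[x0 x1]; have x01 : 0 <= x <= 1 by rewrite x0 ltW.
apply/cvgrPdist_le => e e0; have [d d0 hd] := deriv_on01P fg x01 e0.
(* As x < 1, increments below 1 - x keep x + t in [0, 1], where the extension agrees with f. *)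
have D0 : 0 < Num.min d (1 - x) by rewrite lt_min d0 subr_gt0.
have /cvgrPdist_lt/(_ _ D0) := t0; apply: filterS => n.
rewrite sub0r normrN gtr0_norm // lt_min => /andP[td tx].
have y01 : 0 <= x + t n <= 1 by have := tp n; move: x0 tx; lra.
have := hd _ y01; rewrite [x + t n - x]addrAC subrr add0r gtr0_norm // => /(_ td) h.
rewrite /quot (clampE f y01) (clampE f x01) -(ler_pM2r (tp n)).
rewrite -[X in _ * X <= _](gtr0_norm (tp n)) -normrM mulrBl distrC mulrAC.
by rewrite mulVf ?gt_eqF // mul1r.
Qed.

Lemma bounded_measurable_deriv : bounded_measurable g.
Proof.
have [] // := @unit_dominated_convergence (fun n => quot n.+1%:R^-1) g M.
- by move=> n x _; apply: quot_le; rewrite invr_gt0.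
- move=> x hx; apply: (@quot_cvg (fun n => n.+1%:R^-1)) => //.
  exact: cvg_harmonic.
Qed.

(* [g] need not be continuous, nor even Riemann integrable. *)
Lemma Rintegral_deriv_on01 u v : 0 <= u -> u <= v -> v < 1 ->
  \int[mu]_(x in `[u, v[) g x = f v - f u.
Proof.
(* The increments are at most 1 - v, so the shifted interval [u + t, v + t[ stays within the unit
   interval. *)
move=> u0 uv v1; pose t n : R := (1 - v) / n.+1%:R.
have vp : 0 < 1 - v by rewrite subr_gt0.
have tp n : 0 < t n by rewrite divr_gt0.
have tv n : v + t n <= 1.
  by rewrite -lerBrDl /t ler_pdivrMr // ler_peMr ?ler1n // ltW.
have t0 : t n @[n --> \oo] --> 0.
  by rewrite -(mulr0 (1 - v)); apply: cvgM; [exact: cvg_cst|exact: cvg_harmonic].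
have sub a c : 0 <= a -> c <= 1 -> `[a, c[%classic `<=` I.
  move=> a0 c1 x /=; rewrite !in_itv /= => /andP[ax xc].
  by rewrite (le_trans a0 ax) (lt_le_trans xc c1).
have int h a c : bounded_measurable h -> 0 <= a -> c <= 1 ->
    mu.-integrable `[a, c[ (EFin \o h).
  by move=> hh a0 c1; apply: bounded_measurable_integrable => //; exact: sub.
have split_int a d c : 0 <= a -> a <= d -> d <= c -> c <= 1 ->
    \int[mu]_(x in `[a, c[) F x = \int[mu]_(x in `[a, d[) F x + \int[mu]_(x in `[d, c[) F x.
  move=> a0 ad dc c1; rewrite (@itv_bndbnd_setU _ _ _ (BLeft d)) ?bnd_simp //.
  rewrite Rintegral_setU //.
    rewrite -itv_bndbnd_setU ?bnd_simp //; apply: int => //.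
    exact: bounded_measurable_clamp.
  apply/disj_setPS => x [] /=; rewrite !in_itv /= => /andP[_ xd] /andP[dx _].
  by move: dx; rewrite leNgt xd.
(* By the Lipschitz bound, the average of [F] over [a, a + t[ differs from [F a] by at most M t. *)
have mean a n : 0 <= a -> a + t n <= 1 ->
    `|(t n)^-1 * \int[mu]_(x in `[a, a + t n[) F x - F a| <= M * t n.
  move=> a0 at1; have hF := int _ a (a + t n) bounded_measurable_clamp a0 at1.
  have hc k := int _ a (a + t n) (bounded_measurable_cst k) a0 at1.
  have ci k : \int[mu]_(x in `[a, a + t n[) k = k * t n.
    rewrite Rintegral_cst // /= lebesgue_measure_itv /= lte_fin ltrDl tp /=.
    by rewrite addrAC subrr add0r.
  have bnd x : `[a, a + t n[%classic x -> F a - M * t n <= F x <= F a + M * t n.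
    rewrite /= in_itv /= => /andP[ax xa]; rewrite -ler_distl.
    apply: le_trans (F_lip _ _) _; rewrite ler_wpM2l //.
    by rewrite ger0_norm ?subr_ge0 //; lra.
  have h1 : (F a - M * t n) * t n <= \int[mu]_(x in `[a, a + t n[) F x.
    by rewrite -ci; apply: le_Rintegral => // x /bnd /andP[].
  have h2 : \int[mu]_(x in `[a, a + t n[) F x <= (F a + M * t n) * t n.
    by rewrite -ci; apply: le_Rintegral => // x /bnd /andP[].
  rewrite ler_distl [_^-1 * _]mulrC ler_pdivlMr // ler_pdivrMr //.
  by rewrite h1 h2.
have mean_cvg a : 0 <= a <= v ->
    (t n)^-1 * \int[mu]_(x in `[a, a + t n[) F x @[n --> \oo] --> F a.
  move=> /andP[a0 av]; apply/cvgrPdist_le => e e0.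
  have M1 : 0 < M + 1 by rewrite ltr_wpDl.
  have /cvgrPdist_lt/(_ (e / (M + 1)) (divr_gt0 e0 M1)) := t0.
  apply: filterS => n; rewrite sub0r normrN gtr0_norm // ltr_pdivlMr // => h.
  rewrite distrC; apply: le_trans (mean a n a0 _) _.
    by apply: le_trans (tv n); rewrite lerD2r.
  by have := tp n; lra.
have [_ /(_ `[u, v[%classic (measurable_itv _) (sub _ _ u0 (ltW v1)))] :=
  @unit_dominated_convergence (fun n => quot (t n)) g M (fun n => bm_quot (t n))
  (fun n x _ => quot_le x (tp n)) (fun x hx => quot_cvg tp t0 hx).
have uI : 0 <= u <= 1 by rewrite u0 (le_trans uv) // ltW.
have vI : 0 <= v <= 1 by rewrite (le_trans u0 uv) ltW.
rewrite -(clampE f vI) -(clampE f uI).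
move=> H; apply: cvg_unique H _ => //.
have v01 : 0 <= v <= v by rewrite lexx (le_trans u0).
have u01 : 0 <= u <= v by rewrite u0.
(* The integrated quotient is the average over [v, v + t[ minus the average over [u, u + t[. *)
apply: cvg_trans (cvgB (mean_cvg v v01) (mean_cvg u u01)).
apply: near_eq_cvg; apply: nearW => n /=.
have tn := tp n; have tvn := tv n.
rewrite -mulrBr RintegralZl //; last first.
  apply: int => //; last exact: ltW.
  apply: bounded_measurableD; last first.
    apply: (@lipschitz_bounded_measurable _ M) => x y.
    by rewrite opprK addrC distrC.
  apply: (@lipschitz_bounded_measurable _ M) => x y.
  by apply: le_trans (F_lip _ _) _; rewrite opprD addrACA subrr addr0.
congr (_ * _); rewrite RintegralB //; last 2 first.
- apply: int => //; last exact: ltW.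
  apply: (@lipschitz_bounded_measurable _ M) => x y.
  by apply: le_trans (F_lip _ _) _; rewrite opprD addrACA subrr addr0.
- by apply: int => //; [exact: bounded_measurable_clamp|exact: ltW].
rewrite -(Rintegral_translate (A := `[u + t n, v + t n[) bounded_measurable_clamp) //.
(* Splitting the integral over [u, v + t[ once at v and once at u + t gives the telescoping
   identity. *)
- have tn0 := ltW tn.
  have e1 := split_int u v (v + t n) u0 uv; rewrite lerDl tn0 in e1.
  have e2 := split_int u (u + t n) (v + t n) u0; rewrite lerDl lerD2r tn0 uv in e2.
  have H (a c p q w : R) : w = a + c -> w = p + q -> c - p = q - a by lra.
  exact: H (e1 isT tvn) (e2 isT isT tvn).
- by apply: sub => //; rewrite addr_ge0 // ltW.
- by apply: sub => //; exact: ltW.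
- by apply/seteqP; split => x /=; rewrite !in_itv /= lerD2r ltrD2r.
Qed.

End BoundedDerivative.
End UnitDerivative.

(** * Limits of Walsh coefficients *)

Section WalshLimit.
Variables (R : realType) (b : nat).
Hypothesis hb : (1 < b)%N.
Local Notation mu := (@lebesgue_measure R).
Local Notation I := (`[0%R, 1%R[%classic : set R).
Implicit Types (f g : R -> R) (x : R).

Let b_gt0 : 0 < b%:R :> R. Proof. by rewrite ltr0n ltnW. Qed.
Let bn_gt0 n : 0 < b%:R ^+ n :> R. Proof. exact: exprn_gt0. Qed.

Section digit_average.
Variables (m : nat) (phi : nat -> nat -> R).
Hypothesis phi0 : forall c, \sum_(d < b) phi d c = 0.

(** In the application, [phi d c] is the real or imaginary part of the conjugate Walsh function,
    seen as a function of the a-th digit d and of the index c of the first m digits. *)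
Definition digit_quotient f a x : R :=
  b%:R^-1 * \sum_(d < b) phi d (cell b m x) *
    (b%:R ^+ a * (f (set_digit b a d x) - f x)).

Lemma bounded_measurable_digit_quotient f a : (0 < a)%N ->
  bounded_measurable f -> bounded_measurable (digit_quotient f a).
Proof.
move=> a0 hf; apply: bounded_measurableM; first exact: bounded_measurable_cst.
apply: bounded_measurable_sum => d; apply: bounded_measurableM.
  exact: bounded_measurable_cell.
apply: bounded_measurableM; first exact: bounded_measurable_cst.
apply: bounded_measurableD; first exact: bounded_measurable_set_digit.
under eq_fun do rewrite -mulN1r.
by apply: bounded_measurableM => //; exact: bounded_measurable_cst.
Qed.

(** Split the integral by the value d of the a-th digit and translate each piece with
    [Rintegral_set_digit]. Because m < a, changing this digit does not affect the first m digits on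
    which [phi] depends. *)
Lemma Rintegral_digit_quotient f a : (m < a)%N -> bounded_measurable f ->
  b%:R ^+ a * \int[mu]_(x in I) (f x * phi (real_digit b x a) (cell b m x))
    = \int[mu]_(x in I) digit_quotient f a x.
Proof.
move=> ma hf; have a0 : (0 < a)%N by exact: leq_ltn_trans ma.
have hphi d : bounded_measurable (fun x => f x * phi d (cell b m x)).
  by apply: bounded_measurableM => //; exact: bounded_measurable_cell.
have hsphi (d : 'I_b) : bounded_measurable (fun x => f (set_digit b a d x) * phi d (cell b m x)).
  apply: bounded_measurableM; first exact: bounded_measurable_set_digit.
  exact: bounded_measurable_cell.
have hind (d : 'I_b) : bounded_measurable
    (fun x => (real_digit b x a == d)%:R * (f x * phi d (cell b m x))).
  apply: bounded_measurableM => //.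
  exact: (bounded_measurable_digit hb a (fun c => (c == d)%:R)).
rewrite (_ : \int[mu]_(x in I) _ =
  \int[mu]_(x in I) \sum_(d < b)
    ((real_digit b x a == d)%:R * (f x * phi d (cell b m x)))); last first.
  apply: eq_unit_Rintegral => x hx.
  rewrite (bigD1 (Ordinal (real_digit_lt hb x a))) //= eqxx mul1r.
  rewrite big1 ?addr0 // => j /eqP hj; case: eqP => [e|]; last by rewrite mul0r.
  by case: hj; apply: val_inj.
rewrite unit_Rintegral_sum //.
under eq_bigr => d _ do rewrite (Rintegral_set_digit hb a0 (ltn_ord d) (hphi d)).
rewrite -mulr_sumr (eq_bigr (fun d : 'I_b =>
  \int[mu]_(x in I) (f (set_digit b a d x) * phi d (cell b m x)))); last first.
  move=> d _; apply: eq_unit_Rintegral => x hx.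
  by rewrite (cell_set_digit hb a0 (ltn_ord d) hx ma).
rewrite -unit_Rintegral_sum // mulrA -unit_RintegralZ; last exact: bounded_measurable_sum.
apply: eq_unit_Rintegral => x hx; rewrite /digit_quotient.
rewrite [_ ^+ a * _]mulrC -mulrA; congr (_ * _).
rewrite mulr_sumr; apply/esym; under eq_bigr do rewrite mulrBr mulrBr.
rewrite sumrB; under [X in _ - X]eq_bigr do rewrite mulrC.
(* The weights sum to 0, so subtracting [f x] from every term changes nothing. *)
rewrite -[X in _ - X]mulr_sumr phi0 mulr0 subr0.
by apply: eq_bigr => d _; rewrite mulrCA [phi _ _ * _]mulrC.
Qed.

Lemma digit_quotient_cvg f g x : deriv_on01 f g -> 0 <= x < 1 ->
  digit_quotient f a x @[a --> \oo]
    --> g x * (b%:R^-1 * \sum_(d < b) d%:R * phi d (cell b m x)).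
Proof.
move=> fg hx; have /andP[x0 x1] := hx; have x01 : 0 <= x <= 1 by rewrite x0 ltW.
set S := \sum_(d < b) _; pose B := \sum_(d < b) `|phi d (cell b m x)|.
have B0 : 0 <= B by apply: sumr_ge0.
apply/cvgrPdist_le => e e0; have B1 : 0 < B + 1 by rewrite ltr_wpDl.
(* [B] may be 0, hence the denominator B + 1. *)
have e'0 : 0 < e / (B + 1) by rewrite divr_gt0.
have [dl dl0 hd] := deriv_on01P fg x01 e'0.
have small : \forall a \near \oo, b%:R / b%:R ^+ a < dl.
  have bi : (b%:R : R) * b%:R^-1 ^+ a @[a --> \oo] --> 0.
    rewrite -(mulr0 (b%:R : R)); apply: cvgM; first exact: cvg_cst.
    by apply: cvg_expr; rewrite gtr0_norm ?invr_gt0 // invf_lt1 // ltr1n.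
  have /cvgrPdist_lt/(_ _ dl0) := bi; apply: filterS => a.
  by rewrite sub0r normrN exprVn gtr0_norm // divr_gt0.
near=> a.
have a0 : (0 < a)%N by near: a; exists 1%N.
have sm : b%:R / b%:R ^+ a < dl by near: a.
pose j := real_digit b x a.
have E (d : 'I_b) :
    `|g x * (d%:R - j%:R) - b%:R ^+ a * (f (set_digit b a d x) - f x)|
      <= e / (B + 1) * b%:R.
  have dj : `|d%:R - j%:R| <= b%:R :> R.
    have jb : j%:R <= b%:R :> R by rewrite ler_nat ltnW // real_digit_lt.
    have db : d%:R <= b%:R :> R by rewrite ler_nat ltnW.
    have := ler0n R d; have := ler0n R j => ? ?.
    by rewrite ler_norml; apply/andP; split; lra.
  have sE : set_digit b a d x - x = (d%:R - j%:R) / b%:R ^+ a.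
    by rewrite /set_digit addrAC subrr add0r.
  have s01 : 0 <= set_digit b a d x <= 1.
    by have /andP[-> /ltW] := set_digit_itv hb a0 (ltn_ord d) hx.
  have nE : `|set_digit b a d x - x| = `|d%:R - j%:R| / b%:R ^+ a.
    by rewrite sE normrM [`|_^-1|]gtr0_norm ?invr_gt0.
  have sd : `|set_digit b a d x - x| < dl.
    by apply: le_lt_trans sm; rewrite nE ler_pM2r ?invr_gt0.
  have := hd _ s01 sd; rewrite nE sE => h.
  rewrite distrC -[X in `|_ - g x * X|](divfK (lt0r_neq0 (bn_gt0 a))).
  rewrite mulrA [_ * b%:R ^+ a]mulrC -mulrBr normrM gtr0_norm //.
  rewrite -ler_pdivlMl //; apply: le_trans h _; rewrite [leRHS]mulrC -[leRHS]mulrA.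
  by rewrite ler_pM2l // ler_pM2r ?invr_gt0.
(* The digit j of x depends on a, yet it can be inserted in the limit since the weights sum to 0;
   each term then becomes a first-order error of f at x. *)
have -> : g x * (b%:R^-1 * S) - digit_quotient f a x =
    b%:R^-1 * \sum_(d < b) phi d (cell b m x) *
      (g x * (d%:R - j%:R) - b%:R ^+ a * (f (set_digit b a d x) - f x)).
  rewrite /digit_quotient mulrCA -mulrBr; congr (_ * _).
  under [in RHS]eq_bigr do rewrite mulrBr.
  rewrite sumrB; congr (_ - _).
  under [in RHS]eq_bigr do rewrite mulrCA mulrBr.
  rewrite -mulr_sumr sumrB -mulr_suml phi0 mul0r subr0; congr (_ * _).
  by apply: eq_bigr => d _; rewrite mulrC.
rewrite normrM gtr0_norm ?invr_gt0 // ler_pdivrMl //.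
apply: le_trans (ler_norm_sum _ _ _) _.
apply: (@le_trans _ _ (\sum_(d < b) `|phi d (cell b m x)| * (e / (B + 1) * b%:R))).
  by apply: ler_sum => d _; rewrite normrM ler_wpM2l.
rewrite -mulr_suml -/B mulrA mulrC ler_pM2l // mulrA ler_pdivrMr //.
by lra.
Unshelve. all: by end_near.
Qed.

Lemma Rintegral_digit_cvg f g (M : R) : deriv_on01 f g ->
  (forall x, 0 <= x <= 1 -> `|g x| <= M) ->
  b%:R ^+ a * \int[mu]_(x in I) (f x * phi (real_digit b x a) (cell b m x)) @[a --> \oo]
    --> \int[mu]_(x in I) (g x * (b%:R^-1 * \sum_(d < b) d%:R * phi d (cell b m x))).
Proof.
move=> fg gM; have hf := bounded_measurable_primitive fg gM.
have M0 : 0 <= M.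
  have z01 : 0 <= (0 : R) <= 1 by rewrite lexx ler01.
  exact: le_trans (normr_ge0 _) (gM _ z01).
pose B := fun c => \sum_(d < b) `|phi d c|.
have [_ [C hC]] := bounded_measurable_cell hb m B.
have hle a x : (0 < a)%N -> 0 <= x < 1 -> `|digit_quotient f a x| <= C * M.
  move=> a0 hx; rewrite /digit_quotient normrM gtr0_norm ?invr_gt0 // ler_pdivrMl //.
  apply: le_trans (ler_norm_sum _ _ _) _.
  apply: (@le_trans _ _ (\sum_(d < b) `|phi d (cell b m x)| * (M * b%:R))).
    apply: ler_sum => d _; rewrite normrM ler_wpM2l // normrM gtr0_norm //.
    have x01 : 0 <= x <= 1 by case/andP: hx => -> /ltW.
    have s01 : 0 <= set_digit b a d x <= 1.
      by have /andP[-> /ltW] := set_digit_itv hb a0 (ltn_ord d) hx.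
    rewrite -ler_pdivlMl //; apply: le_trans (deriv_on01_lipschitz fg gM s01 x01) _.
    rewrite mulrCA ler_wpM2l // /set_digit addrAC subrr add0r normrM mulrC.
    rewrite [`|_^-1|]gtr0_norm ?invr_gt0 // ler_pM2l ?invr_gt0 //.
    have jb : (real_digit b x a)%:R <= b%:R :> R by rewrite ler_nat ltnW // real_digit_lt.
    have db : d%:R <= b%:R :> R by rewrite ler_nat ltnW.
    have := ler0n R d; have := ler0n R (real_digit b x a) => ? ?.
    by rewrite ler_norml; apply/andP; split; lra.
  rewrite -mulr_suml mulrA mulrC ler_pM2l // ler_wpM2r //.
  exact: le_trans (ler_norm _) (hC x hx).
(* The identity with [digit_quotient] holds from a = m + 1 on, so the sequence is started there. *)
rewrite -(cvg_shiftn m.+1).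
have [n|n x hx|x hx|_ H] := @unit_dominated_convergence R
    (fun n => digit_quotient f (n + m.+1))
    (fun x => g x * (b%:R^-1 * \sum_(d < b) d%:R * phi d (cell b m x))) (C * M).
- by apply: bounded_measurable_digit_quotient => //; rewrite addnS.
- by apply: hle => //; rewrite addnS.
- rewrite (cvg_shiftn m.+1 (fun n => digit_quotient f n x)).
  exact: digit_quotient_cvg.
- apply: cvg_trans (H I (@measurable_unit_itv R) (@subset_refl _ I)).
  apply: near_eq_cvg; apply: nearW => n /=.
  by rewrite Rintegral_digit_quotient // addnS ltnS leq_addl.
Qed.

End digit_average.
End WalshLimit.

Local Open Scope complex_scope.
Local Open Scope ring_scope.

(** * Limits and integrals of complex-valued functions *)

Section ComplexIntegral.
Variable R : realType.
Local Notation mu := (@lebesgue_measure R).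
Local Notation I := (`[0%R, 1%R[%classic : set R).
Implicit Types (f g : R -> R) (h : R -> R[i]) (x : R).

Lemma ReD (y z : R[i]) : complex.Re (y + z) = complex.Re y + complex.Re z.
Proof. by case: y z => [? ?] [? ?]. Qed.

Lemma ImD (y z : R[i]) : complex.Im (y + z) = complex.Im y + complex.Im z.
Proof. by case: y z => [? ?] [? ?]. Qed.

Lemma ReM (y z : R[i]) : complex.Re (y * z) =
  complex.Re y * complex.Re z - complex.Im y * complex.Im z.
Proof. by case: y z => [? ?] [? ?]. Qed.

Lemma ImM (y z : R[i]) : complex.Im (y * z) =
  complex.Re y * complex.Im z + complex.Im y * complex.Re z.
Proof. by case: y z => [? ?] [? ?]. Qed.

Lemma complexP (y z : R[i]) : complex.Re y = complex.Re z ->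
  complex.Im y = complex.Im z -> y = z.
Proof. by case: y z => [? ?] [? ?] /= -> ->. Qed.

Lemma complex_cvg (u : nat -> R[i]) (l : R[i]) :
  complex.Re (u n) @[n --> \oo] --> complex.Re l ->
  complex.Im (u n) @[n --> \oo] --> complex.Im l ->
  u n @[n --> \oo] --> (l : R[i]^o).
Proof.
move=> /cvgrPdist_le hr /cvgrPdist_le hi; apply/(@cvgrPdist_le _ (R[i]^o)) => -[e e'] /=.
(* A positive element of [R[i]] has imaginary part 0, so the tolerance is a real number. *)
rewrite ltcE /= => /andP[/eqP -> e0].
have e2 : 0 < e / 2 by rewrite divr_gt0.
apply: filterS2 (hr _ e2) (hi _ e2) => n; case: (u n) => [p q]; case: l {hr hi} => [s t] /=.
move=> h1 h2; rewrite lecE /= eqxx /=.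
apply: le_trans (_ : `|s - p| + `|t - q| <= _); last lra.
rewrite -[leRHS]ger0_norm ?addr_ge0 // -sqrtr_sqr ler_sqrt ?sqr_ge0 //.
rewrite [leRHS]sqrrD -(real_normK (num_real (s - p))) -(real_normK (num_real (t - q))).
by rewrite lerD2r lerDl mulrn_wge0 // mulr_ge0.
Qed.

Definition complex_bounded_measurable h : Prop :=
  bounded_measurable (fun x => complex.Re (h x)) /\
  bounded_measurable (fun x => complex.Im (h x)).

Lemma complex_bounded_measurableM h1 h2 :
  complex_bounded_measurable h1 -> complex_bounded_measurable h2 ->
  complex_bounded_measurable (fun x => h1 x * h2 x).
Proof.
move=> [r1 i1] [r2 i2]; split.
  under eq_fun do rewrite ReM -mulNr -mulN1r.
  apply: bounded_measurableD; apply: bounded_measurableM => //.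
  by apply: bounded_measurableM => //; exact: bounded_measurable_cst.
by under eq_fun do rewrite ImM; apply: bounded_measurableD; exact: bounded_measurableM.
Qed.

Lemma complex_bounded_measurable_cst (c : R[i]) : complex_bounded_measurable (fun=> c).
Proof. by split; exact: bounded_measurable_cst. Qed.

Lemma complex_bounded_measurable_real f : bounded_measurable f ->
  complex_bounded_measurable (fun x => (f x)%:C).
Proof. by split => //; exact: bounded_measurable_cst. Qed.

Lemma complex_bounded_measurable_cell b n (psi : nat -> R[i]) : (1 < b)%N ->
  complex_bounded_measurable (fun x => psi (cell b n x)).
Proof.
move=> hb; split; first exact: (bounded_measurable_cell hb n (fun c => complex.Re (psi c))).
exact: (bounded_measurable_cell hb n (fun c => complex.Im (psi c))).
Qed.

Lemma eq_cintegral h1 h2 : (forall x, 0 <= x < 1 -> h1 x = h2 x) ->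
  cintegral I h1 = cintegral I h2.
Proof. by move=> e; apply: complexP => /=; apply: eq_unit_Rintegral => x /e ->. Qed.

Lemma cintegralZ (c : R[i]) h : complex_bounded_measurable h ->
  cintegral I (fun x => c * h x) = c * cintegral I h.
Proof.
move=> [hr hi]; apply: complexP; rewrite ?ReM ?ImM /=.
  under eq_Rintegral do rewrite ReM -mulNr.
  by rewrite unit_RintegralD ?unit_RintegralZ ?mulNr //;
    apply: bounded_measurableM => //; exact: bounded_measurable_cst.
under eq_Rintegral do rewrite ImM.
by rewrite unit_RintegralD ?unit_RintegralZ //;
  apply: bounded_measurableM => //; exact: bounded_measurable_cst.
Qed.

Lemma cintegral_sum n (h : 'I_n -> R -> R[i]) :
  (forall k, complex_bounded_measurable (h k)) ->
  cintegral I (fun x => \sum_(k < n) h k x) = \sum_(k < n) cintegral I (h k).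
Proof.
move=> hh; have sumRe m (z : 'I_m -> R[i]) :
    complex.Re (\sum_(k < m) z k) = \sum_(k < m) complex.Re (z k).
  exact: (big_morph _ ReD).
have sumIm m (z : 'I_m -> R[i]) :
    complex.Im (\sum_(k < m) z k) = \sum_(k < m) complex.Im (z k).
  exact: (big_morph _ ImD).
apply: complexP; rewrite /= ?sumRe ?sumIm.
  under eq_Rintegral do rewrite sumRe.
  by rewrite unit_Rintegral_sum // => k; case: (hh k).
under eq_Rintegral do rewrite sumIm.
by rewrite unit_Rintegral_sum // => k; case: (hh k).
Qed.

End ComplexIntegral.

(** * Walsh coefficients as the leading exponent tends to infinity *)

Section WalshCoefficients.
Variables (R : realType) (b : nat).
Hypothesis hb : (1 < b)%N.
Local Notation mu := (@lebesgue_measure R).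
Local Notation I := (`[0%R, 1%R[%classic : set R).
Local Notation w := (omega R b).
Implicit Types (f g : R -> R) (x : R).

Lemma complex_bounded_measurable_walsh k : complex_bounded_measurable (fun x => (walsh b k x)^*).
Proof.
have kk : (k < b ^ k)%N := ltn_expl k hb.
have [[hr hrb] [hi hib]] := complex_bounded_measurable_cell k
  (fun c => (walsh b k (c%:R / b%:R ^+ k : R))^*) hb.
split; split.
- apply: eq_measurable_fun hr => x; rewrite inE unit_itvP => /andP[x0 _].
  by rewrite -walsh_cell.
- case: hrb => M hM; exists M => x hx; have := hM x hx.
  by rewrite -walsh_cell //; case/andP: hx.
- apply: eq_measurable_fun hi => x; rewrite inE unit_itvP => /andP[x0 _].
  by rewrite -walsh_cell.
- case: hib => M hM; exists M => x hx; have := hM x hx.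
  by rewrite -walsh_cell //; case/andP: hx.
Qed.

Lemma walsh_coef_cvg f g (M : R) kappa k m : deriv_on01 f g ->
  (forall x, 0 <= x <= 1 -> `|g x| <= M) ->
  (0 < kappa < b)%N -> (k < b ^ m)%N ->
  b%:R ^+ a * walsh_coef b f (kappa * b ^ a.-1 + k) @[a --> \oo]
    --> (slope R b kappa * walsh_coef b g k : R[i]^o).
Proof.
move=> fg gM hk km; have kb : (kappa < b)%N by case/andP: hk.
pose psi c : R[i] := (walsh b k (c%:R / b%:R ^+ m : R))^*.
have walshE' a x : (m < a)%N -> 0 <= x < 1 ->
    (walsh b (kappa * b ^ a.-1 + k) x)^* = w^* ^+ (kappa * real_digit b x a) * psi (cell b m x).
  move=> ma hx; rewrite walsh_add //; last 2 first.
  - exact: leq_ltn_trans ma.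
  - exact: nat_digit_small km ma.
  by rewrite rmorphM /= rmorphXn /= /psi -walsh_cell //; case/andP: hx.
have target : slope R b kappa * walsh_coef b g k =
    cintegral I (fun x => (g x)%:C *
      (b%:R^-1 * \sum_(d < b) d%:R * (w^* ^+ (kappa * d) * psi (cell b m x)))).
  rewrite /walsh_coef -cintegralZ; last first.
    apply: complex_bounded_measurableM; last exact: complex_bounded_measurable_walsh.
    by apply: complex_bounded_measurable_real; exact: bounded_measurable_deriv fg gM.
  apply: eq_cintegral => x /andP[x0 _]; rewrite mulrCA; congr (_ * _).
  rewrite /slope -mulrA; congr (_ * _); rewrite mulr_suml.
  by apply: eq_bigr => d _; rewrite /psi -walsh_cell // mulrA.
(* One argument serves for the real and the imaginary part: only additivity and homogeneity over the
   reals are used of [P]. *)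
have part (P : R[i] -> R) : (forall y z, P (y + z) = P y + P z) ->
    (forall (r : R) z, P (r%:C * z) = r * P z) ->
  b%:R ^+ a * \int[mu]_(x in I) P ((f x)%:C * (walsh b (kappa * b ^ a.-1 + k) x)^*)
    @[a --> \oo] --> \int[mu]_(x in I) P ((g x)%:C *
      (b%:R^-1 * \sum_(d < b) d%:R * (w^* ^+ (kappa * d) * psi (cell b m x)))).
  move=> PD PZ; pose phi d c := P (w^* ^+ (kappa * d) * psi c).
  have P0 : P 0 = 0 by have := PZ 0 0; rewrite mulr0 mul0r.
  have Psum n (F : 'I_n -> R[i]) : P (\sum_(d < n) F d) = \sum_(d < n) P (F d).
    exact: (big_morph P PD P0).
  (* The cancellation is the vanishing sum of conj(omega)^(kappa d), which requires kappa to be a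
     nonzero digit. *)
  have phi0 c : \sum_(d < b) phi d c = 0.
    by rewrite -Psum -mulr_suml sum_omega_conj // mul0r.
  have natC n : n%:R = (n%:R : R)%:C by rewrite rmorph_nat.
  have H := Rintegral_digit_cvg hb (m := m) phi0 fg gM.
  rewrite (_ : \int[mu]_(x in I) P _ = \int[mu]_(x in I)
      (g x * (b%:R^-1 * \sum_(d < b) d%:R * phi d (cell b m x)))); last first.
    apply: eq_unit_Rintegral => x hx; rewrite PZ natC -fmorphV PZ Psum.
    by congr (_ * (_ * _)); apply: eq_bigr => d _; rewrite natC PZ.
  apply: cvg_trans H; apply: near_eq_cvg; near=> a.
  congr (_ * _); apply: eq_unit_Rintegral => x hx; rewrite PZ walshE' //.
  by near: a; exists m.+1.
rewrite target; have bE a : b%:R ^+ a = (b%:R ^+ a : R)%:C by rewrite rmorphXn /= rmorph_nat.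
apply: complex_cvg.
- have PZ (r : R) z : complex.Re (r%:C * z) = r * complex.Re z.
    by rewrite ReM /= mul0r subr0.
  apply: cvg_trans (part (@complex.Re R) (@ReD R) PZ).
  by apply: near_eq_cvg; apply: nearW => a; rewrite bE PZ.
- have PZ (r : R) z : complex.Im (r%:C * z) = r * complex.Im z.
    by rewrite ImM /= mul0r addr0.
  apply: cvg_trans (part (@complex.Im R) (@ImD R) PZ).
  by apply: near_eq_cvg; apply: nearW => a; rewrite bE PZ.
Unshelve. all: by end_near.
Qed.

End WalshCoefficients.

(** * Functions with vanishing Walsh coefficients *)

Section VanishingWalsh.
Variables (R : realType) (b : nat).
Hypothesis hb : (1 < b)%N.
Local Notation mu := (@lebesgue_measure R).
Local Notation I := (`[0%R, 1%R[%classic : set R).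
Local Notation w := (omega R b).
Implicit Types (f g : R -> R) (x : R).

Let bn_gt0 n : 0 < b%:R ^+ n :> R. Proof. by rewrite exprn_gt0 // ltr0n ltnW. Qed.

Lemma is_expansion_cons kappa a e : (0 < kappa < b)%N -> (lead_exp e < a)%N ->
  is_expansion b e -> is_expansion b ((kappa, a) :: e).
Proof.
move=> hk ha; rewrite /is_expansion /= hk (leq_ltn_trans _ ha) //= => /andP[-> /=].
by move: ha; rewrite /lead_exp; case: (unzip2 e) => //= c l -> ->.
Qed.

(** Each limit trades one leading term of the expansion for one derivative and a factor [slope]. By
    induction the inner limits [u a] are known for every admissible a; the outer sequence then
    converges by [walsh_coef_cvg], and uniqueness of limits identifies l. *)
Lemma iterated_limit_walsh (F : nat -> R -> R) n :
  (forall i, (i < n)%N -> deriv_on01 (F i) (F i.+1)) ->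
  (forall i, (i <= n)%N -> exists M : R, forall x, 0 <= x <= 1 -> `|F i x| <= M) ->
  forall ds e (l : R[i]), (size ds <= n)%N -> all (fun d => 0 < d < b)%N ds ->
    is_expansion b e -> iterated_limit b (walsh_coef b (F 0%N)) ds e l ->
  l = (\prod_(kappa <- ds) slope R b kappa) * walsh_coef b (F (size ds)) (expansion_val b e).
Proof.
move=> dF bF; elim=> [|kappa ds IH] e l /=.
  by move=> _ _ _ <-; rewrite big_nil mul1r.
move=> sn /andP[hk hds] he [u [hu hl]].
have [M hM] := bF _ sn.
have cv := walsh_coef_cvg hb (dF _ sn) hM hk (expansion_val_lt hb he).
rewrite big_cons [slope _ _ _ * _]mulrC -mulrA.
set P := \prod_(j <- _) _; set L := slope _ _ _ * _ in cv *.
apply: (@cvg_unique (R[i]^o) (@norm_hausdorff _ (R[i]^o)) _ _ l (P * L) hl).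
have cvP : ((fun=> P) : nat -> R[i]^o) @ \oo --> (P : R[i]^o) by exact: cvg_cst.
apply: cvg_trans (cvgM cvP cv).
apply: near_eq_cvg; near=> a.
have ha : (lead_exp e < a)%N by near: a; exists (lead_exp e).+1.
have := IH _ _ (ltnW sn) hds (is_expansion_cons hk ha he) (hu a ha).
by rewrite expansion_val_cons -/P => ->; rewrite /= mulrCA.
Unshelve. all: by end_near.
Qed.

(** Induction on n works because k is arbitrary among the multiples of b^n. The indicator of a finer
    interval is that of a coarser one times that of digit n + 1, and the latter is an average over j
    of omega^(j (c mod b)) times conj(omega)^(j x_(n+1)). As k has digit 0 at position n + 1, the
    second factor merges with the Walsh function into the one of index j b^n + k, again a multiple
    of b^n. *)
Lemma cintegral_cell_eq0 g : bounded_measurable g ->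
  (forall k, walsh_coef b g k = 0) -> forall n c k, (b ^ n %| k)%N ->
  cintegral I (fun x => (g x)%:C * ((cell b n x == c)%:R * (walsh b k x)^*)) = 0.
Proof.
move=> hg g0.
have hgC := complex_bounded_measurable_real hg.
have hcell n c := complex_bounded_measurable_cell n (fun j => (j == c)%:R : R[i]) hb.
have hwalsh := complex_bounded_measurable_walsh R hb.
elim=> [|n IH] c k hk.
  transitivity ((0%N == c)%:R * walsh_coef b g k); last by rewrite g0 mulr0.
  rewrite /walsh_coef -cintegralZ; last exact: complex_bounded_measurableM.
  by apply: eq_cintegral => x hx; rewrite cell0 // mulrCA.
have b0 : (0 < b)%N by exact: ltnW.
have bC : b%:R != 0 :> R[i] by rewrite pnatr_eq0 -lt0n.
have kn : nat_digit b k n.+1 = 0%N.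
  have /dvdnP[q ->] := hk; rewrite /nat_digit /= expnS mulnA mulnK ?expn_gt0 ?b0 //.
  by rewrite modnMl.
pose h (j : 'I_b) x : R[i] := w ^+ (j * (c %% b)) *
  ((g x)%:C * ((cell b n x == c %/ b)%N%:R * (walsh b (j * b ^ n + k) x)^*)).
have hh j : complex_bounded_measurable (h j).
  apply: complex_bounded_measurableM; first exact: complex_bounded_measurable_cst.
  by apply: complex_bounded_measurableM => //; exact: complex_bounded_measurableM.
have E : b%:R * cintegral I (fun x => (g x)%:C * ((cell b n.+1 x == c)%:R * (walsh b k x)^*))
    = cintegral I (fun x => \sum_(j < b) h j x).
  rewrite -cintegralZ; last first.
    by apply: complex_bounded_measurableM => //; exact: complex_bounded_measurableM.
  apply: eq_cintegral => x hx; have x0 : 0 <= x by case/andP: hx.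
  have -> : (cell b n.+1 x == c) = (cell b n x == c %/ b)%N && (real_digit b x n.+1 == c %% b)%N.
    rewrite -(cell_divn hb n 1 x0) addn1 expn1 real_digitE.
    apply/eqP/andP => [->|[/eqP e1 /eqP e2]]; first by rewrite !eqxx.
    by rewrite (divn_eq (cell b n.+1 x) b) e1 e2 -divn_eq.
  rewrite -mulnb natrM.
  transitivity ((g x)%:C * ((cell b n x == c %/ b)%N%:R *
      ((if real_digit b x n.+1 == (c %% b)%N then b else 0%N)%:R * (walsh b k x)^*))).
    rewrite mulrCA; congr (_ * _); rewrite -mulrA mulrCA; congr (_ * _).
    by rewrite mulrA -natrM; case: eqP; rewrite ?muln1 ?muln0.
  rewrite -(omega_orthogonal R hb) ?ltn_mod ?real_digit_lt //.
  rewrite mulr_suml !mulr_sumr; apply: eq_bigr => j _; rewrite /h.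
  rewrite -[n in (_ * b ^ n)%N]/(n.+1.-1) walsh_add // rmorphM /=.
  by rewrite [(w ^+ _)^*]rmorphXn /=; ring.
apply: (mulfI bC); rewrite mulr0 E cintegral_sum //; apply: big1 => j _.
rewrite /h cintegralZ; last first.
  by apply: complex_bounded_measurableM => //; exact: complex_bounded_measurableM.
rewrite IH ?mulr0 // dvdn_add ?dvdn_mull //.
by apply: dvdn_trans hk; rewrite dvdn_exp2l.
Qed.

(** The case k = 0 of [cintegral_cell_eq0] makes f equal at neighbouring points of each grid c /
    b^n. These grids are dense, and f is Lipschitz. *)
Lemma walsh_coef_eq0_const f g (M : R) : deriv_on01 f g ->
  (forall x, 0 <= x <= 1 -> `|g x| <= M) ->
  (forall k, walsh_coef b g k = 0) -> forall x, 0 <= x <= 1 -> f x = f 0.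
Proof.
move=> fg gM g0; have hg := bounded_measurable_deriv fg gM.
have M0 : 0 <= M.
  have z01 : 0 <= (0 : R) <= 1 by rewrite lexx ler01.
  exact: le_trans (normr_ge0 _) (gM _ z01).
have step n c : (c.+1 < b ^ n)%N -> f (c.+1%:R / b%:R ^+ n) = f (c%:R / b%:R ^+ n).
  move=> hc; apply/eqP; rewrite -subr_eq0; apply/eqP.
  rewrite -(Rintegral_deriv_on01 fg gM); last 3 first.
  - by rewrite divr_ge0 // ltW.
  - by rewrite ler_pM2r ?invr_gt0 // ler_nat.
  - by rewrite ltr_pdivrMr // mul1r -natrX ltr_nat.
  have := cintegral_cell_eq0 hg g0 (n := n) c (dvdn0 _).
  move=> /(congr1 (@complex.Re R)) /= <-.
  rewrite -[RHS](@eq_unit_Rintegral _ (fun x => (cell b n x == c)%:R * g x)); last first.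
    move=> x hx; rewrite walsh0 // rmorph1 mulr1 [in RHS]mulrC.
    by case: eqP => _; rewrite ?mul1r ?mul0r.
  rewrite (_ : `[_, _[%classic = I `&` [set x | cell b n x = c]).
    rewrite Rintegral_mkcondr; apply: eq_Rintegral => x _.
    rewrite /restrict; case: eqP => h; last by rewrite memNset ?mul0r.
    by rewrite mem_set // mul1r.
  apply/seteqP; split => x /=; rewrite !in_itv /=.
    move=> /andP[h1 h2]; have x0 : 0 <= x by apply: le_trans h1; rewrite divr_ge0 // ltW.
    split; last by apply/eqP; rewrite cellP // h1 h2.
    rewrite x0 (lt_le_trans h2) // ler_pdivrMr // mul1r -natrX ler_nat.
    exact: ltnW.
  by move=> [/andP[x0 _] /eqP]; rewrite cellP.
have grid n c : (c < b ^ n)%N -> f (c%:R / b%:R ^+ n) = f 0.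
  elim: c => [|c IH] hc; first by rewrite mul0r.
  by rewrite step // IH // ltnW.
move=> x x01; have /andP[x0 x1] := x01.
have near_grid n : exists2 c, (c < b ^ n)%N & `|x - c%:R / b%:R ^+ n| <= (b%:R ^+ n)^-1.
  have bp : (0 < b ^ n)%N by rewrite expn_gt0 ltnW.
  move: x1; rewrite le_eqVlt => /predU1P[->|x1].
    (* The grid stops short of 1, so the endpoint is approximated by the last grid point, at
       distance exactly b^(-n). *)
    exists (b ^ n).-1; first by rewrite ltn_predL.
    rewrite -subn1 natrB // natrX mulrBl divff ?gt_eqF // opprB addrC subrK mul1r.
    by rewrite gtr0_norm // invr_gt0.
  have x01' : 0 <= x < 1 by rewrite x0.
  exists (cell b n x); first exact: cell_lt.
  have := eqxx (cell b n x); rewrite cellP // => /andP[h1 h2].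
  rewrite ger0_norm ?subr_ge0 //.
  by move: h2; rewrite -natr1 mulrDl mul1r; lra.
apply/eqP; rewrite -subr_eq0 -normr_le0; apply/ler_addgt0Pl => e e0; rewrite addr0.
have M1 : 0 < M + 1 by rewrite ltr_wpDl.
have small : \forall n \near \oo, (b%:R ^+ n)^-1 < e / (M + 1).
  have : (b%:R : R)^-1 ^+ n @[n --> \oo] --> 0.
    apply: cvg_expr; rewrite gtr0_norm ?invr_gt0 ?ltr0n 1?ltnW //.
    by rewrite invf_lt1 ?ltr0n 1?ltnW // ltr1n.
  move=> /cvgrPdist_lt/(_ _ (divr_gt0 e0 M1)); apply: filterS => n.
  by rewrite sub0r normrN exprVn gtr0_norm // invr_gt0.
have [n hn] := filter_ex small.
have [c hc hxc] := near_grid n.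
rewrite -(grid n c hc); apply: le_trans (deriv_on01_lipschitz fg gM x01 _) _.
  have -> : 0 <= c%:R / b%:R ^+ n :> R by rewrite divr_ge0 // ltW.
  by rewrite ler_pdivrMr // mul1r -natrX ler_nat ltnW.
move: hn; rewrite ltr_pdivlMr // => hn.
have := ler_wpM2l M0 hxc; have : 0 < (b%:R ^+ n)^-1 :> R by rewrite invr_gt0.
by lra.
Qed.

End VanishingWalsh.

(** * Boundedness from finite variation, and integration back to a polynomial *)

Section Conclusion.
Variable R : realType.
Implicit Types (f g : R -> R) (x : R).

(** Test the supremum on the partition 0 < x < 1. Its steps have length d at most 1, so d^lambda is
    at most 1 and dividing by it only enlarges the terms. *)
Lemma order_variation_bounded (lambda : R) g : 0 <= lambda ->
  (order_variation lambda g < +oo)%E ->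
  exists M : R, forall x, 0 <= x <= 1 -> `|g x| <= M.
Proof.
move=> l0 hV; have [C hC] : exists C : R, forall x, 0 < x < 1 ->
    x * `|g x - g 0| + (1 - x) * `|g 1 - g x| <= C.
  exists (fine (order_variation lambda g)) => x /andP[x0 x1].
  have ge (d z : R) : 0 < d -> d <= 1 -> 0 <= z -> d * z <= d * (z / d `^ lambda) :> R.
    move=> d0 d1 z0; rewrite ler_pM2l // ler_pdivlMr ?powR_gt0 // ler_piMr //.
    have -> : 1 = 1 `^ lambda :> R by rewrite powR1.
    by rewrite ge0_ler_powR // nnegrE // ltW.
  have y0 : 0 < 1 - x by rewrite subr_gt0.
  have y1 : 1 - x <= 1 by rewrite gerBl ltW.
  pose S : R := \sum_(n < size [:: x; 1])
      (let d := `|[:: x; 1]`_n - (0 :: [:: x; 1])`_n| in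
       d * (`|g [:: x; 1]`_n - g (0 :: [:: x; 1])`_n| / d `^ lambda)).
  have SE : S = x * (`|g x - g 0| / x `^ lambda) + (1 - x) * (`|g 1 - g x| / (1 - x) `^ lambda).
    by rewrite /S /= !big_ord_recl big_ord0 /= subr0 addr0 [`|x|]gtr0_norm // [`|1 - x|]gtr0_norm.
  have hS : (S%:E <= order_variation lambda g)%E.
    apply: ereal_sup_ubound; exists [:: x; 1] => //.
    by split; rewrite /= ?x0 ?x1.
  apply: (@le_trans _ _ S).
    by rewrite SE lerD // ge // ltW.
  by move: hS hV; case: (order_variation _ _) => [v|//|//]; rewrite lee_fin.
exists (`|g 0| + `|g 1| + `|C| *+ 2) => x /andP[x0 x1].
have g0 := normr_ge0 (g 0); have g1 := normr_ge0 (g 1); have C0 := normr_ge0 C.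
move: x0; rewrite le_eqVlt => /predU1P[<-|x0]; first by lra.
move: x1; rewrite le_eqVlt => /predU1P[->|x1]; first by lra.
have := hC x; rewrite x0 x1 => /(_ isT) h.
have a1 := normr_ge0 (g x - g 0); have a2 := normr_ge0 (g 1 - g x).
have n0 : `|g x| <= `|g 0| + `|g x - g 0|.
  by rewrite -[in leLHS](subrK (g 0) (g x)) addrC ler_normD.
have n1 : `|g x| <= `|g 1| + `|g 1 - g x|.
  by rewrite -[in leLHS](subKr (g 1) (g x)) ler_normB.
(* One of x and 1 - x is at least 1/2, which bounds the distance from g(x) to g(0) or to g(1) by
   2|C|. *)
have hCC := ler_norm C; have [xh|xh] := leP x 2^-1; nra.
Qed.

(** Collects the nested intermediate derivatives into one sequence. The top one agrees with g on
    [0, 1] only, since [nderiv_on01] fixes values there alone. *)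
Lemma nderiv_on01_chain n f g : nderiv_on01 n f g ->
  exists F : nat -> R -> R, [/\ F 0%N = f,
    forall i, (i < n)%N -> deriv_on01 (F i) (F i.+1) &
    forall x, 0 <= x <= 1 -> g x = F n x].
Proof.
elim: n f => [f fg|n IH f [h fh /IH[F [F0 dF Fn]]]].
  by exists (fun=> f).
exists (fun i => if i is j.+1 then F j else f); split => // -[|i] /=.
  by rewrite F0.
exact: dF.
Qed.

Lemma chain_bounded n (F : nat -> R -> R) :
  (forall i, (i < n)%N -> deriv_on01 (F i) (F i.+1)) ->
  (exists M : R, forall x, 0 <= x <= 1 -> `|F n x| <= M) ->
  forall i, (i <= n)%N -> exists M : R, forall x, 0 <= x <= 1 -> `|F i x| <= M.
Proof.
(* The bound descends from the top derivative, so the induction runs on the distance j from n. *)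
move=> dF hn; have H j : (j <= n)%N ->
    exists M : R, forall x, 0 <= x <= 1 -> `|F (n - j)%N x| <= M.
  elim: j => [|j IH] jn; first by rewrite subn0.
  have [M hM] := IH (ltnW jn).
  apply: (deriv_on01_bounded (g := F (n - j)%N) _ hM).
  by rewrite -(subnSK jn); apply: dF; rewrite subnSK // leq_subr.
by move=> i ile; rewrite -(subKn ile); apply: H; exact: leq_subr.
Qed.

Lemma deriv_on01_poly f g (p : {poly R}) j : deriv_on01 f g ->
  (size p <= j)%N -> (forall x, 0 <= x <= 1 -> g x = p.[x]) ->
  exists q : {poly R}, (size q <= j.+1)%N /\ forall x, 0 <= x <= 1 -> f x = q.[x].
Proof.
(* At i = 0 the division by zero yields the coefficient 0; the constant of integration is added
   separately. *)
move=> fg pj gp; pose q := \poly_(i < j.+1) (p`_i.-1 / i%:R).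
have q' : q^`() = p.
  apply/polyP => i; rewrite coef_deriv coef_poly ltnS.
  case: ltnP => ij; last by rewrite mul0rn nth_default // (leq_trans pj).
  by rewrite /= -[LHS]mulr_natr divfK // pnatr_eq0.
exists (q + (f 0 - q.[0])%:P); split.
  rewrite (leq_trans (size_polyD _ _)) // geq_max size_poly.
  by rewrite (leq_trans (size_polyC_leq1 _)).
move=> x /andP[x0 x1]; rewrite hornerD hornerC.
have [||c] := @MVT_segment _ (f - horner q) (fun y => g y - p.[y]) 0 x x0.
- move=> y; rewrite in_itv /= => /andP[y0 yx].
  have h1 : is_derive y 1 f (g y).
    by apply: deriv_on01_is_derive => //; rewrite y0 (lt_le_trans yx).
  have h2 := is_derive_poly q y; rewrite q' in h2.
  exact: is_deriveB.
- have cf : {within `[0, x], continuous f}.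
    apply: continuous_subspaceW (deriv_on01_continuous fg).
    move=> z /=; rewrite !in_itv /= => /andP[z0 zx].
    by rewrite z0 (le_trans zx).
  have cq : {within `[0, x], continuous (horner q)}.
    by apply: continuous_subspaceT => z; exact: continuous_horner.
  by move=> y; apply: cvgB; [exact: cf|exact: cq].
rewrite in_itv /= => /andP[c0 cx]; rewrite gp ?subrr ?mul0r; last first.
  by rewrite c0 (le_trans cx).
by rewrite !fctE => h; lra.
Qed.

End Conclusion.

Theorem theorem5 (R : realType) (b : nat) (hb : (2 <= b)%N)
  (r : R) (hr : 1 < r) (f : R -> R) (hf : smooth r f)
  (s : nat) (hs1 : (1 <= s)%N) (hsr : s%:R <= r)
  (hlim : forall (kappa : s.-tuple nat) (e : seq (nat * nat)),
     all (fun d => (0 < d < b)%N) kappa -> is_expansion b e ->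
     iterated_limit b (walsh_coef b f) (rev kappa) e 0) :
  exists p : {poly R}, (size p <= s)%N /\
    forall x : R, 0 <= x <= 1 -> f x = p.[x].
Proof.
case: hf => g hg hV; have r0 : 0 <= r by rewrite ltW // (lt_trans ltr01).
have [F [F0 dF Fn]] := nderiv_on01_chain hg.
have sn : (s <= Num.truncn r)%N by rewrite -(@natrK R s) le_truncn.
have l0 : 0 <= r - (Num.truncn r)%:R by rewrite subr_ge0 truncn_le.
have bF := chain_bounded dF.
have {}bF : forall i, (i <= Num.truncn r)%N ->
    exists M : R, forall x, 0 <= x <= 1 -> `|F i x| <= M.
  apply: bF; have [M hM] := order_variation_bounded l0 hV.
  by exists M => x hx; rewrite -Fn // hM.
have wF0 k : walsh_coef b (F s) k = 0.
  have [he ek] := expansion_ofP k hb.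
  (* Taking every digit equal to 1 and the expansion of k as the fixed tail, the iterated limit is
     slope(1)^s times the k-th coefficient of [F s], and slope(1) is nonzero. *)
  have hd : all (fun d => 0 < d < b)%N (nseq s 1%N) by rewrite all_nseq hb orbT.
  have H : iterated_limit b (walsh_coef b (F 0%N)) (rev (nseq s 1%N)) (expansion_of b k) 0.
    by rewrite F0; exact: (hlim [tuple of nseq s 1%N]).
  have := iterated_limit_walsh hb (n := s)
    (fun i hi => dF i (leq_trans hi sn)) (fun i hi => bF i (leq_trans hi sn)) _ _ he H.
  rewrite size_rev size_nseq all_rev ek => /(_ (leqnn _) hd)/esym/eqP.
  rewrite mulf_eq0 => /orP[|/eqP//]; rewrite prodf_seq_eq0 has_rev => /hasP[d].
  by rewrite mem_nseq => /andP[_ /eqP ->] /=; rewrite (negbTE (slope_neq0 R hb _)) ?hb.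
(* Descending from [F (s - 1)], which is constant, each integration raises the degree by at most
   one; j = s - 1 reaches f. *)
have H j : (j < s)%N -> exists p : {poly R}, (size p <= j.+1)%N /\
    forall x : R, 0 <= x <= 1 -> F (s - j.+1)%N x = p.[x].
  elim: j => [|j IH] js.
    have ss : (s - 1).+1 = s by rewrite subn1 prednK.
    have [M hM] := bF s sn.
    have ds : deriv_on01 (F (s - 1)%N) (F s).
      by have := dF (s - 1)%N; rewrite ss; exact.
    exists (F (s - 1)%N 0)%:P; split; first exact: size_polyC_leq1.
    move=> x hx; rewrite hornerC; exact: walsh_coef_eq0_const hb _ _ _ ds hM wF0 _ hx.
  have [p [sp hp]] := IH (ltnW js).
  apply: deriv_on01_poly sp hp; rewrite -(subnSK js); apply: dF.
  by rewrite subnSK // (leq_trans (leq_subr _ _)).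
have [] := H s.-1; first by rewrite prednK.
by move=> p; rewrite prednK // subnn F0 => hp; exists p.
Qed.
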